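(* Let $\Omega\subset\mathbb{C}^d$ be a bounded open set which is locally convexifiable and has finite local line type $L$, and let $\{(V_\xi,\Phi_\xi):\xi\in\partial\Omega\}$ be a good locally convex atlas. Then there exist $c,\epsilon>0$ such that $$K_\Omega(p;v)\le K_{\Omega\cap V_\xi}(p;v)\le e^{c\,\delta_\Omega(p)^{1/L}}K_\Omega(p;v)$$ for every $\xi\in\partial\Omega$, every $p\in B_\epsilon(\xi)\cap\Omega$ and every $v\in\mathbb{C}^d$.
   Context: $K_\Omega(p;v)=\inf\{|\zeta|: f:\Delta\to\Omega\text{ holomorphic}, f(0)=p, df(\zeta)=v\}$ is the infinitesimal Kobayashi metric. $\delta_\Omega(p)$ is the Euclidean distance to $\mathbb{C}^d\setminus\Omega$, and $\delta_\Omega(p;v)=\inf\{\|q-p\|:q\in(p+\mathbb{C}v)\setminus\Omega\}$. A local convex chart at $\xi\in\partial\Omega$ is a pair $(V_\xi,\Phi_\xi)$ with $V_\xi$ a neighborhood of $\xi$ and $\Phi_\xi:V_\xi\to\mathbb{C}^d$ a biholomorphism onto its image such that $\Omega_\xi:=\Phi_\xi(V_\xi\cap\Omega)$ is convex; a locally convex atlas is a choice of such a chart for every $\xi\in\partial\Omega$, and $\Omega$ is locally convexifiable if one exists. $\Omega$ has finite local line type $L$ if $\partial\Omega$ is a $C^L$ hypersurface and there is a locally convex atlas such that each hypersurface $\Phi_\xi(\partial\Omega\cap V_\xi)$ has line type at most $L$ near $\Phi_\xi(\xi)$, with equality attained for some $\xi$; here the line type of a hypersurface $\{r=0\}$ at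 $x$ is the supremum over non-trivial complex affine $\ell:\mathbb{C}\to\mathbb{C}^d$ with $\ell(0)=x$ of the order of vanishing of $r\circ\ell$ at $0$. A locally convex atlas is good if there are $C,\tau>0$ such that for every $\xi\in\partial\Omega$: $B_\tau(\xi)\subset V_\xi$; $\delta_{\Omega_\xi}(p;v)\le C\delta_{\Omega_\xi}(p)^{1/L}$ for all $p\in\Omega_\xi$ and $v\neq0$; and $C^{-1}\|p-q\|\le\|\Phi_\xi(p)-\Phi_\xi(q)\|\le C\|p-q\|$ for all $p,q\in V_\xi$. *)

(* Defs.v *)
(* C^n is modelled as R^n x R^n (real and imaginary
   parts), R : realType; complex structure is added by hand. *)
From HB Require Import structures.
From mathcomp Require Import all_boot all_order all_algebra.
From mathcomp Require Import all_classical all_reals all_analysis.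
Set Implicit Arguments. Unset Strict Implicit. Unset Printing Implicit Defensive.
Import Order.TTheory GRing.Theory Num.Theory.
Import numFieldNormedType.Exports.
Local Open Scope classical_set_scope.
Local Open Scope ring_scope.

Section Defs.
Variable R : realType.

(* C^n : a point (x, y) stands for x + i y *)
Definition Cn (n : nat) := ('rV[R]_n * 'rV[R]_n)%type.

Definition cscale n (a b : R) (z : Cn n) : Cn n :=
  (a *: z.1 - b *: z.2, a *: z.2 + b *: z.1).

Definition Jc n (z : Cn n) : Cn n := cscale 0 1 z.

Definition enorm n (z : Cn n) : R :=
  Num.sqrt (\sum_(i < n) (z.1 ord0 i ^+ 2 + z.2 ord0 i ^+ 2)).

Definition eball n (x : Cn n) (r : R) : set (Cn n) :=
  [set y | enorm (y - x) < r].

Definition unit_disc : set (Cn 1) := [set z | enorm z < 1].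

Definition ebounded n (U : set (Cn n)) : Prop :=
  exists M : R, forall z, U z -> enorm z <= M.

Definition boundary n (U : set (Cn n)) : set (Cn n) := closure U `\` U.

Definition convex_cn n (U : set (Cn n)) : Prop :=
  forall x y (t : R), U x -> U y -> 0 <= t <= 1 -> U ((1 - t) *: x + t *: y).

Definition holomorphic_on m n (f : Cn m -> Cn n) (U : set (Cn m)) : Prop :=
  forall z, U z -> differentiable f z /\
    forall h : Cn m, 'd f z (Jc h) = Jc ('d f z h).

Definition biholomorphic_onto_image n (f : Cn n -> Cn n) (V : set (Cn n)) : Prop :=
  open V /\ open (f @` V) /\ holomorphic_on f V /\
  exists g : Cn n -> Cn n, holomorphic_on g (f @` V) /\
    (forall z, V z -> g (f z) = z) /\ (forall w, (f @` V) w -> f (g w) = w).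

Fixpoint Ck n (k : nat) (f : Cn n -> R) (U : set (Cn n)) : Prop :=
  match k with
  | 0 => forall x, U x -> {for x, continuous f}
  | k'.+1 => (forall x, U x -> differentiable f x) /\
             forall v : Cn n, Ck k' (fun x => 'D_v f x) U
  end.

Definition local_defining_fun n (k : nat) (S : set (Cn n)) (W : set (Cn n))
    (r : Cn n -> R) : Prop :=
  open W /\ Ck k r W /\ (forall y, W y -> exists h, 'd r y h != 0) /\
  (forall y, W y -> (S y <-> r y = 0)).

Definition Ck_hypersurface n (k : nat) (S : set (Cn n)) : Prop :=
  forall x, S x -> exists W r, W x /\ local_defining_fun k S W r.

Definition vanishes_to_order (g : Cn 1 -> R) (m : nat) : Prop :=
  exists C d : R, 0 < d /\ forall t, enorm t < d -> `|g t| <= C * enorm t ^+ m.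

Definition along n (r : Cn n -> R) (x v : Cn n) : Cn 1 -> R :=
  fun t => r (x + cscale (t.1 ord0 ord0) (t.2 ord0 ord0) v).

Definition line_type_le_near n (L : nat) (S : set (Cn n)) (x0 : Cn n) : Prop :=
  exists W r, W x0 /\ local_defining_fun L S W r /\
    forall x v, W x -> S x -> v != 0 -> ~ vanishes_to_order (along r x v) L.+1.

Definition line_type_ge_at n (L : nat) (S : set (Cn n)) (x0 : Cn n) : Prop :=
  exists W r, W x0 /\ local_defining_fun L S W r /\
    exists v, v != 0 /\ vanishes_to_order (along r x0 v) L.

Definition locally_convex_atlas n (Omega : set (Cn n))
    (V : Cn n -> set (Cn n)) (Phi : Cn n -> Cn n -> Cn n) : Prop :=
  forall xi, boundary Omega xi ->
    V xi xi /\ biholomorphic_onto_image (Phi xi) (V xi) /\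
    convex_cn (Phi xi @` (V xi `&` Omega)).

Definition locally_convexifiable n (Omega : set (Cn n)) : Prop :=
  exists V Phi, locally_convex_atlas Omega V Phi.

Definition finite_local_line_type n (Omega : set (Cn n)) (L : nat) : Prop :=
  Ck_hypersurface L (boundary Omega) /\
  exists V Phi, locally_convex_atlas Omega V Phi /\
    (forall xi, boundary Omega xi ->
       line_type_le_near L (Phi xi @` (boundary Omega `&` V xi)) (Phi xi xi)) /\
    (exists xi, boundary Omega xi /\
       line_type_ge_at L (Phi xi @` (boundary Omega `&` V xi)) (Phi xi xi)).

(* delta_U(p) : distance to the complement (+oo if the complement is empty) *)
Definition dist_bd n (U : set (Cn n)) (p : Cn n) : \bar R :=
  ereal_inf [set (enorm (q - p))%:E | q in ~` U].

Definition dist_dir n (U : set (Cn n)) (p v : Cn n) : \bar R :=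
  ereal_inf [set (enorm (q - p))%:E | q in
    [set p + cscale a b v | a in [set: R] & b in [set: R]] `&` ~` U].

Definition good_atlas n (Omega : set (Cn n)) (L : nat)
    (V : Cn n -> set (Cn n)) (Phi : Cn n -> Cn n -> Cn n) : Prop :=
  locally_convex_atlas Omega V Phi /\
  exists C tau : R, 0 < C /\ 0 < tau /\
    forall xi, boundary Omega xi ->
      eball xi tau `<=` V xi /\
      (forall p v, (Phi xi @` (V xi `&` Omega)) p -> v != 0 ->
         (dist_dir (Phi xi @` (V xi `&` Omega)) p v <=
          C%:E * poweR (dist_bd (Phi xi @` (V xi `&` Omega)) p) L%:R^-1)%E) /\
      (forall p q, V xi p -> V xi q ->
         C^-1 * enorm (p - q) <= enorm (Phi xi p - Phi xi q) /\
         enorm (Phi xi p - Phi xi q) <= C * enorm (p - q)).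

Definition kobayashi n (U : set (Cn n)) (p v : Cn n) : \bar R :=
  ereal_inf [set (enorm zeta)%:E | zeta in
    [set zeta : Cn 1 | exists f : Cn 1 -> Cn n,
       holomorphic_on f unit_disc /\ (forall z, unit_disc z -> U (f z)) /\
       f 0 = p /\ 'd f 0 zeta = v]].

End Defs.

(* Main.v *)
(* The analytic content is that a holomorphic disc f : D -> Omega with f(0) = p
   close to xi maps the disc of radius 1 - C' delta, delta = delta_Omega(p), into
   the ball of radius tau around xi; rescaling the disc then gives the comparison
   of the two metrics.  Let r be the largest radius with f(D_r) in that ball and
   g = Phi o f, a map of D_r into a convex domain W.  A hyperplane near Phi(p) and
   Harnack's inequality give delta_W(g(z)) <= c delta / (r - |z|); the half-plane
   derivative bound in the direction g'(z) gives |g'(z)| (r - |z|) <=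
   4 delta_W(g(z); g'(z)), which is at most c (delta / (r - |z|))^(1/L).
   Integrating along a radius, f stays close to p up to |z| = r - K delta.  As f is
   bounded, leaving the ball within the remaining distance K delta forces
   1 - r <= C' delta.

   Complex differentiability is only assumed pointwise, so the bound
   |h'(0)| <= 2 Re h(0) for Re h >= 0 is derived from Goursat's bisection lemma:
   in logarithmic coordinates the mean over circles of
   Re ((h - h(0)) (1 - (z/r + r/z)/2)) does not depend on the radius; on |z| = r
   the second factor is 1 - cos >= 0, and at the origin the mean tends to
   - r Re h'(0) / 2. *)
Require Import Defs.
From HB Require Import structures.
From mathcomp Require Import all_boot all_order all_algebra.
From mathcomp Require Import all_classical all_reals all_analysis.
From mathcomp Require Import ring lra.
Import Order.TTheory GRing.Theory Num.Theory.
Import numFieldNormedType.Exports.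
Local Open Scope classical_set_scope.
Local Open Scope ring_scope.

(** * Goursat's lemma for closed forms on rectangles *)
Section Goursat.
Variable R : realType.
Implicit Types (f g : R -> R) (P Q : R -> R -> R).
Notation mu := (@lebesgue_measure R).

Definition itv_int f (a b : R) : R := \int[mu]_(x in `[a, b]) f x.

Definition cont_on f (a b : R) := forall x, a <= x <= b -> {for x, continuous f}.

Lemma cont_on_integrable f a b :
  cont_on f a b -> mu.-integrable `[a, b] (EFin \o f).
Proof.
move=> cf; apply: continuous_compact_integrable; first exact: segment_compact.
by apply: continuous_in_subspaceT => x; rewrite inE/= in_itv/=; exact: cf.
Qed.

Lemma itv_int_split f a m b : a <= m -> m <= b -> cont_on f a b ->
  itv_int f a b = itv_int f a m + itv_int f m b.
Proof.
move=> am mb cf.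
have cmb : cont_on f m b.
  by move=> x /andP[mx xb]; apply: cf; rewrite xb (le_trans am mx).
rewrite /itv_int -(Rintegral_itv_obnd_cbnd (r := m)); last first.
  apply: integrableS (cont_on_integrable _ _ _ cmb) => //.
  by apply: subset_itvr; rewrite bnd_simp.
rewrite -(Rintegral_itvB (x := m) (cont_on_integrable _ _ _ cf)) ?bnd_simp//.
by rewrite addrC subrK.
Qed.

Lemma itv_intB f g a b : cont_on f a b -> cont_on g a b ->
  itv_int (fun x => f x - g x) a b = itv_int f a b - itv_int g a b.
Proof. by move=> cf cg; apply: RintegralB => //; exact: cont_on_integrable. Qed.

Lemma itv_int_cst k a b : a <= b -> itv_int (fun=> k) a b = k * (b - a).
Proof.
move=> ab; rewrite /itv_int Rintegral_cst//= lebesgue_measure_itv/= lte_fin.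
by case: ltgtP ab => //= -> _; rewrite subrr mulr0.
Qed.

Lemma cont_on_cst k a b : cont_on (fun=> k) a b.
Proof. by move=> x _; exact: cvg_cst. Qed.

Lemma le_itv_int f g a b : cont_on f a b -> cont_on g a b ->
  (forall x, a <= x <= b -> f x <= g x) -> itv_int f a b <= itv_int g a b.
Proof.
move=> cf cg fg; by apply: le_Rintegral => //; exact: cont_on_integrable.
Qed.

Lemma itv_int_near f k e a b : a <= b -> cont_on f a b ->
  (forall x, a <= x <= b -> `|f x - k| <= e) ->
  `|itv_int f a b - k * (b - a)| <= e * (b - a).
Proof.
move=> ab cf fk; rewrite ler_distl; apply/andP; split.
  rewrite -mulrBl -(itv_int_cst _ _ _ ab); apply: le_itv_int => //.
    exact: cont_on_cst.
  by move=> x /fk; rewrite ler_distl => /andP[].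
rewrite -mulrDl -(itv_int_cst _ _ _ ab); apply: le_itv_int => //.
  exact: cont_on_cst.
by move=> x /fk; rewrite ler_distl => /andP[].
Qed.

(* [B] is at once dP/dy and dQ/dx, i.e. [P dx + Q dy] is closed at [(x, y)];
   nothing is assumed about continuity of the partial derivatives. *)
Definition closed_form_at P Q (x y : R) := exists A B C : R,
  forall e, 0 < e -> exists2 d, 0 < d & forall h k, `|h| < d -> `|k| < d ->
    `|P (x + h) (y + k) - P x y - (A * h + B * k)| <= e * (`|h| + `|k|) /\
    `|Q (x + h) (y + k) - Q x y - (B * h + C * k)| <= e * (`|h| + `|k|).

Lemma affine_approx_continuous f x A :
  (forall e, 0 < e -> exists2 d, 0 < d & forall h, `|h| < d ->
    `|f (x + h) - f x - A * h| <= e * `|h|) -> {for x, continuous f}.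
Proof.
move=> fA; apply/cvgrPdist_le => /= e e0.
have [d d0 fd] := fA 1 ltr01.
have A1 : 0 < `|A| + 1 by rewrite ltr_wpDl.
have d'0 : 0 < Num.min d (e / (`|A| + 1)) by rewrite lt_min d0 divr_gt0.
near=> t.
have td : `|t - x| < Num.min d (e / (`|A| + 1)).
  by rewrite distrC; near: t; exact: cvgr_dist_lt.
move: td; rewrite lt_min => /andP[/fd].
rewrite (addrC x) subrK mul1r ltr_pdivlMr// => H /ltW te.
rewrite distrC (le_trans _ te)// -(subrK (A * (t - x)) (f t - f x)).
rewrite (le_trans (ler_normD _ _))// normrM.
by move: H; lra.
Unshelve. all: by end_near. Qed.

(** Continuity in each variable follows from the first-order expansion, and it makes the integrals
    along the sides of a rectangle well behaved. *)
Lemma closed_form_continuous P Q x y : closed_form_at P Q x y ->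
  {for x, continuous (P^~ y)} /\ {for y, continuous (Q x)}.
Proof.
move=> [A [B [C H]]]; split.
  apply: (affine_approx_continuous _ _ A) => e /H[d d0 Hd]; exists d => // h hd.
  have := (Hd h 0 hd); rewrite normr0 d0 => /(_ isT)[+ _].
  by rewrite !addr0 mulr0 addr0.
apply: (affine_approx_continuous _ _ C) => e /H[d d0 Hd]; exists d => // h hd.
have := (Hd 0 h); rewrite normr0 d0 => /(_ isT hd)[_].
by rewrite addr0 mulr0 !add0r.
Qed.

(* The integral of [P dx + Q dy] along the positively oriented boundary. *)
Definition rect_int P Q (a b c d : R) :=
  itv_int (Q b) c d - itv_int (Q a) c d
  - (itv_int (P^~ d) a b - itv_int (P^~ c) a b).

Lemma rect_int_split P Q a m b c n d :
  a <= m -> m <= b -> c <= n -> n <= d ->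
  (forall x y, a <= x <= b -> c <= y <= d -> closed_form_at P Q x y) ->
  rect_int P Q a b c d = rect_int P Q a m c n + rect_int P Q m b c n
    + rect_int P Q a m n d + rect_int P Q m b n d.
Proof.
move=> am mb cn nd H.
have cQ x : a <= x <= b -> cont_on (Q x) c d.
  by move=> xab y ycd; have [] := closed_form_continuous _ _ _ _ (H x y xab ycd).
have cP y : c <= y <= d -> cont_on (P^~ y) a b.
  by move=> ycd x xab; have [] := closed_form_continuous _ _ _ _ (H x y xab ycd).
have ab := le_trans am mb; have cd := le_trans cn nd.
rewrite /rect_int.
rewrite (itv_int_split (Q b) c n d) ?(itv_int_split (Q a) c n d)//; last 2 first.
- by apply: cQ; rewrite lexx.
- by apply: cQ; rewrite lexx ab.
rewrite (itv_int_split (P^~ d) a m b) ?(itv_int_split (P^~ c) a m b)//; last 2 first.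
- by apply: cP; rewrite lexx.
- by apply: cP; rewrite lexx cd.
ring.
Qed.

(** Opposite sides are compared: up to an error [e] on each side, the difference of [Q] is
    [B * (b - a)] and that of [P] is [B * (d - c)]. Since [B] is the same number, both integrate to
    [B * (b - a) * (d - c)] and cancel, so that only the errors remain. *)
Lemma rect_int_small P Q x y A B C e a b c d :
  a <= x <= b -> c <= y <= d -> 0 <= e ->
  (forall x y, a <= x <= b -> c <= y <= d -> closed_form_at P Q x y) ->
  (forall x' y', a <= x' <= b -> c <= y' <= d ->
    `|P x' y' - P x y - (A * (x' - x) + B * (y' - y))| <= e /\
    `|Q x' y' - Q x y - (B * (x' - x) + C * (y' - y))| <= e) ->
  `|rect_int P Q a b c d| <= 2 * e * (b - a) + 2 * e * (d - c).
Proof.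
move=> /andP[ax xb] /andP[cy yd] e0 Hc H.
have ab := le_trans ax xb; have cd := le_trans cy yd.
have cQ z : a <= z <= b -> cont_on (Q z) c d.
  by move=> xab t ycd; have [] := closed_form_continuous _ _ _ _ (Hc z t xab ycd).
have cP z : c <= z <= d -> cont_on (P^~ z) a b.
  by move=> ycd t xab; have [] := closed_form_continuous _ _ _ _ (Hc t z xab ycd).
have aI : a <= a <= b by rewrite lexx.
have bI : a <= b <= b by rewrite lexx ab.
have cI : c <= c <= d by rewrite lexx.
have dI : c <= d <= d by rewrite lexx cd.
rewrite /rect_int -itv_intB; [|exact: cQ..].
rewrite -(itv_intB _ _ _ _ (cP _ dI) (cP _ cI)).
have H1 : `|itv_int (fun t => Q b t - Q a t) c d - B * (b - a) * (d - c)|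
    <= 2 * e * (d - c).
  apply: itv_int_near => //.
    by move=> t tcd; apply: cvgB; apply: cQ.
  move=> t tcd; have [_ h1] := H b t bI tcd; have [_ h2] := H a t aI tcd.
  by move: h1 h2; rewrite !ler_norml => /andP[? ?] /andP[? ?]; apply/andP; lra.
have H2 : `|itv_int (fun t => P t d - P t c) a b - B * (d - c) * (b - a)|
    <= 2 * e * (b - a).
  apply: itv_int_near => //.
    by move=> t tcd; apply: cvgB; apply: cP.
  move=> t tcd; have [h1 _] := H t d tcd dI; have [h2 _] := H t c tcd cI.
  by move: h1 h2; rewrite !ler_norml => /andP[? ?] /andP[? ?]; apply/andP; lra.
move: H1 H2; rewrite (mulrAC B (d - c)).
by rewrite !ler_norml => /andP[? ?] /andP[? ?]; apply/andP; lra.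
Qed.

(** Pigeonhole over the four quarters; [i] selects left or right, [j] lower or upper. Writing a
    quarter by its corner and its side lengths lets the step be iterated with lengths
    [l / 2 ^+ n]. *)
Lemma rect_int_quarter P Q a b c d :
  a <= b -> c <= d ->
  (forall x y, a <= x <= b -> c <= y <= d -> closed_form_at P Q x y) ->
  exists i j : bool,
    let l := (b - a) / 2 in let m := (d - c) / 2 in
    let a' := a + i%:R * l in let c' := c + j%:R * m in
    `|rect_int P Q a b c d| <= 4 * `|rect_int P Q a' (a' + l) c' (c' + m)|.
Proof.
move=> ab cd H.
have := rect_int_split P Q a ((a + b) / 2) b c ((c + d) / 2) d.
have -> : a <= (a + b) / 2 by lra.
have -> : (a + b) / 2 <= b by lra.
have -> : c <= (c + d) / 2 by lra.
have -> : (c + d) / 2 <= d by lra.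
move=> /(_ isT isT isT isT H) E.
set e1 := rect_int P Q a ((a + b) / 2) c ((c + d) / 2) in E.
set e2 := rect_int P Q ((a + b) / 2) b c ((c + d) / 2) in E.
set e3 := rect_int P Q a ((a + b) / 2) ((c + d) / 2) d in E.
set e4 := rect_int P Q ((a + b) / 2) b ((c + d) / 2) d in E.
have N : `|rect_int P Q a b c d| <= `|e1| + `|e2| + `|e3| + `|e4|.
  rewrite E (le_trans (ler_normD _ _))// lerD2r.
  by rewrite (le_trans (ler_normD _ _))// lerD2r ler_normD.
have m1 : a + (b - a) / 2 = (a + b) / 2 by lra.
have m2 : c + (d - c) / 2 = (c + d) / 2 by lra.
have m3 : (a + b) / 2 + (b - a) / 2 = b by lra.
have m4 : (c + d) / 2 + (d - c) / 2 = d by lra.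
have [h1|h1] := leP `|rect_int P Q a b c d| (4 * `|e1|).
  by exists false, false; rewrite /= !mul0r !addr0 m1 m2.
have [h2|h2] := leP `|rect_int P Q a b c d| (4 * `|e2|).
  by exists true, false; rewrite /= !mul0r !mul1r !addr0 m1 m2 m3.
have [h3|h3] := leP `|rect_int P Q a b c d| (4 * `|e3|).
  by exists false, true; rewrite /= !mul0r !mul1r !addr0 m1 m2 m4.
have [h4|h4] := leP `|rect_int P Q a b c d| (4 * `|e4|).
  by exists true, true; rewrite /= !mul1r m1 m2 m3 m4.
exfalso; move: N h1 h2 h3 h4; lra.
Qed.

(** Every left endpoint lies below every right endpoint, so the supremum of the left endpoints
    belongs to all the intervals. *)
Lemma nested_itv_point (u : nat -> R) (l : R) : 0 <= l ->
  (forall n, u n <= u n.+1 /\ u n.+1 + l / 2 ^+ n.+1 <= u n + l / 2 ^+ n) ->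
  exists x, forall n, u n <= x <= u n + l / 2 ^+ n.
Proof.
move=> l0 H.
have up m n : (m <= n)%N -> u m <= u n.
  move/subnKC <-; elim: (n - m)%N => [|k IH]; first by rewrite addn0.
  by rewrite addnS (le_trans IH)//; case: (H (m + k)%N).
have dn m n : (m <= n)%N -> u n + l / 2 ^+ n <= u m + l / 2 ^+ m.
  move/subnKC <-; elim: (n - m)%N => [|k IH]; first by rewrite addn0.
  by rewrite addnS (le_trans _ IH)//; case: (H (m + k)%N).
have lp n : 0 <= l / 2 ^+ n by rewrite divr_ge0// exprn_ge0.
have mn m n : u m <= u n + l / 2 ^+ n.
  have [h|/ltnW h] := leqP m n; first by rewrite (le_trans (up _ _ h))// lerDl.
  by rewrite (le_trans _ (dn _ _ h))// lerDl.
exists (sup (range u)) => n; apply/andP; split.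
  apply: sup_upper_bound; last by exists n.
  split; first by exists (u 0%N); exists 0%N.
  by exists (u 0%N + l / 2 ^+ 0) => _ [k _ <-].
apply: ge_sup; first by exists (u 0%N); exists 0%N.
by move=> _ [k _ <-].
Qed.

Lemma half_pow_lt (d : R) : 0 < d -> exists n, 1 / 2 ^+ n < d.
Proof.
move=> d0; have := @cvg_geometric R 1 (1/2); rewrite ger0_norm; last by lra.
have h1 : 1 / 2 < 1 :> R by lra.
move=> /(_ h1) /cvgrPdist_lt /(_ d d0) [N _ HN].
exists N; have := HN N (leqnn N); rewrite /geometric/= sub0r normrN.
by rewrite !mul1r ger0_norm ?exprn_ge0 ?invr_ge0// exprVn.
Qed.

(** Repeated bisection produces nested rectangles shrinking to one point. The expansion there makes
    the n-th integral [o(4^-n)], while each step loses at most a factor 4. *)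
Theorem goursat P Q a b c d : a <= b -> c <= d ->
  (forall x y, a <= x <= b -> c <= y <= d -> closed_form_at P Q x y) ->
  rect_int P Q a b c d = 0.
Proof.
move=> ab cd H.
pose l := b - a; pose m := d - c.
have l0 : 0 <= l by rewrite subr_ge0.
have m0 : 0 <= m by rewrite subr_ge0.
pose E n (p : R * R) :=
  `|rect_int P Q p.1 (p.1 + l / 2 ^+ n) p.2 (p.2 + m / 2 ^+ n)|.
pose inn n (p : R * R) := [/\ a <= p.1, p.1 + l / 2 ^+ n <= b,
  c <= p.2 & p.2 + m / 2 ^+ n <= d].
have lp n : 0 <= l / 2 ^+ n by rewrite divr_ge0// exprn_ge0.
have mp n : 0 <= m / 2 ^+ n by rewrite divr_ge0// exprn_ge0.
have lS n : l / 2 ^+ n.+1 = l / 2 ^+ n / 2 by rewrite exprSr invfM mulrA.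
have mS n : m / 2 ^+ n.+1 = m / 2 ^+ n / 2 by rewrite exprSr invfM mulrA.
(* Guarding the conclusion by [inn] makes the relation total, so that [choice] yields a function;
   outside the rectangle the value is an arbitrary default. *)
have step (np : nat * (R * R)) : exists p' : R * R, inn np.1 np.2 ->
   [/\ E np.1 np.2 <= 4 * E np.1.+1 p', inn np.1.+1 p',
     np.2.1 <= p'.1 /\ p'.1 + l / 2 ^+ np.1.+1 <= np.2.1 + l / 2 ^+ np.1 &
     np.2.2 <= p'.2 /\ p'.2 + m / 2 ^+ np.1.+1 <= np.2.2 + m / 2 ^+ np.1].
  case: np => n [x y]/=.
  have [[/= ax xb cy yd]|nin] := pselect (inn n (x, y)); last by exists (0, 0).
  have := rect_int_quarter P Q x (x + l / 2 ^+ n) y (y + m / 2 ^+ n).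
  rewrite !lerDl lp mp => /(_ isT isT)[x' y' /andP[h1 h2] /andP[h3 h4]|i [j]].
    by apply: H; apply/andP; split; [exact: le_trans h1|exact: le_trans xb|
       exact: le_trans h3|exact: le_trans yd].
  rewrite /= !(addrAC _ _ (- _)) !subrr !add0r -lS -mS => Eq.
  exists (x + i%:R * (l / 2 ^+ n.+1), y + j%:R * (m / 2 ^+ n.+1)) => _.
  have Hl : x <= x + i%:R * (l / 2 ^+ n.+1) /\
    x + i%:R * (l / 2 ^+ n.+1) + l / 2 ^+ n.+1 <= x + l / 2 ^+ n.
    by rewrite lS; have := lp n; case: i Eq => _; rewrite /= ?mul1r ?mul0r; lra.
  have Hm : y <= y + j%:R * (m / 2 ^+ n.+1) /\
    y + j%:R * (m / 2 ^+ n.+1) + m / 2 ^+ n.+1 <= y + m / 2 ^+ n.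
    by rewrite mS; have := mp n; case: j Eq => _; rewrite /= ?mul1r ?mul0r; lra.
  split => //; split => /=.
  - by apply: le_trans Hl.1.
  - by apply: le_trans xb; exact: Hl.2.
  - by apply: le_trans Hm.1.
  - by apply: le_trans yd; exact: Hm.2.
have [nxt Hn] := choice step.
pose s := fix s n := if n is k.+1 then nxt (k, s k) else (a, c).
have sin n : inn n (s n).
  elim: n => [|n IH] /=.
    by split; rewrite /= ?lexx// expr0 divr1 /l /m addrC subrK.
  by have [] := Hn (n, s n) IH.
have sE n : E 0%N (a, c) <= 4 ^+ n * E n (s n).
  elim: n => [|n IH]; first by rewrite expr0 mul1r.
  rewrite (le_trans IH)// exprSr -mulrA ler_wpM2l ?exprn_ge0//.
  by have [] := Hn (n, s n) (sin n).
have [x Hx] : exists x, forall n, (s n).1 <= x <= (s n).1 + l / 2 ^+ n.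
  apply: (nested_itv_point (fun n => (s n).1)) => // n.
  by have [] := Hn (n, s n) (sin n).
have [y Hy] : exists x, forall n, (s n).2 <= x <= (s n).2 + m / 2 ^+ n.
  apply: (nested_itv_point (fun n => (s n).2)) => // n.
  by have [] := Hn (n, s n) (sin n).
have xab : a <= x <= b.
  have := Hx 0%N; have [/= h1 h2 _ _] := sin 0%N => /andP[h3 h4].
  by apply/andP; split => //; apply: le_trans h2.
have ycd : c <= y <= d.
  have := Hy 0%N; have [/= _ _ h1 h2] := sin 0%N => /andP[h3 h4].
  by apply/andP; split => //; apply: le_trans h2.
have [A [B [C HC]]] := H x y xab ycd.
suff : E 0%N (a, c) <= 0.
  rewrite /E /= !expr0 !divr1 /l /m (addrC a) (addrC c) !subrK normr_le0.
  by move/eqP.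
apply/ler_addgt0Pl => e e0; rewrite addr0.
(* With expansion error [e / K], the n-th integral is at most [e / K * w ^ 2 * (2 * (l + m) ^ 2)]
   for [w = 2^-n], and [4 ^ n * w ^ 2 = 1]. The summand 1 keeps [K] positive for a degenerate
   rectangle. *)
pose K := 2 * (l + m) * (l + m) + 1.
have K0 : 0 < K.
  by rewrite /K ltr_wpDl// !mulr_ge0// addr_ge0.
have [dl dl0 Hd] := HC (e / K) (divr_gt0 e0 K0).
have lm0 : 0 < l + m + 1 by lra.
have [n Hnn] := half_pow_lt (dl / (l + m + 1)) (divr_gt0 dl0 lm0).
set w := 1 / 2 ^+ n in Hnn.
have w0 : 0 <= w by rewrite divr_ge0// exprn_ge0.
have {Hnn}wd : w * (l + m + 1) < dl by rewrite -ltr_pdivlMr.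
have lw : l / 2 ^+ n = l * w by rewrite /w mul1r.
have mw : m / 2 ^+ n = m * w by rewrite /w mul1r.
have lwd : l * w < dl.
  by rewrite (le_lt_trans _ wd)// mulrC ler_wpM2l//; lra.
have mwd : m * w < dl.
  by rewrite (le_lt_trans _ wd)// mulrC ler_wpM2l//; lra.
have [/= h1 h2 h3 h4] := sin n.
have := rect_int_small P Q x y A B C (e / K * ((l + m) * w))
  (s n).1 ((s n).1 + l / 2 ^+ n) (s n).2 ((s n).2 + m / 2 ^+ n) (Hx n) (Hy n).
have eK : 0 <= e / K by rewrite divr_ge0 ?ltW.
have -> : 0 <= e / K * ((l + m) * w) by rewrite mulr_ge0// mulr_ge0// addr_ge0.
move=> /(_ isT) /(_ _)/wrap[x' y' /andP[? ?] /andP[? ?]|].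
  by apply: H; apply/andP; split; lra.
move=> /(_ _)/wrap[x' y' xx yy|].
  have xd : `|x' - x| <= l * w.
    have := Hx n; rewrite lw => /andP[? ?]; move: xx; rewrite lw => /andP[? ?].
    by rewrite ler_norml; apply/andP; lra.
  have yd : `|y' - y| <= m * w.
    have := Hy n; rewrite mw => /andP[? ?]; move: yy; rewrite mw => /andP[? ?].
    by rewrite ler_norml; apply/andP; lra.
  have := Hd (x' - x) (y' - y) (le_lt_trans xd lwd) (le_lt_trans yd mwd).
  rewrite (addrC x) (addrC y) !subrK => -[hP hQ].
  have le2 : e / K * (`|x' - x| + `|y' - y|) <= e / K * ((l + m) * w).
    by rewrite ler_wpM2l// mulrDl lerD.
  by split; [exact: le_trans hP le2|exact: le_trans hQ le2].
rewrite -/(E n (s n)) => En.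
have Sn := sE n.
have {En}En : E n (s n) <= e / K * (w * w) * (2 * (l + m) * (l + m)).
  apply: (le_trans En); rewrite lw mw.
  rewrite [X in X <= _](_ : _ = e / K * (w * w) * (2 * (l + m) * (l + m)))//.
  ring.
have ww : 4 ^+ n * (w * w) = 1.
  rewrite (_ : 4 = 2 * 2 :> R)//; last by ring.
  rewrite exprMn /w; field.
  by rewrite expf_neq0.
apply: (le_trans Sn).
apply: (@le_trans _ _ (4 ^+ n * (e / K * (w * w) * (2 * (l + m) * (l + m))))).
  by rewrite ler_wpM2l// exprn_ge0.
rewrite [X in X <= _](_ : _ = (4 ^+ n * (w * w)) * (e / K * (2 * (l + m) * (l + m)))); last by ring.
rewrite ww mul1r mulrAC ler_pdivrMr// ler_wpM2l ?ltW// /K; lra.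
Qed.

(** The horizontal sides cancel by periodicity. In logarithmic coordinates this says that a mean
    over circles does not depend on the radius. *)
Corollary goursat_periodic P Q a b c d : a <= b -> c <= d ->
  (forall x y, a <= x <= b -> c <= y <= d -> closed_form_at P Q x y) ->
  (forall x, P x c = P x d) ->
  itv_int (Q a) c d = itv_int (Q b) c d.
Proof.
move=> ab cd H Pcd; have := goursat P Q a b c d ab cd H.
rewrite /rect_int (_ : P^~ d = P^~ c); last by apply/funext => x.
by rewrite subrr subr0 => /eqP; rewrite subr_eq0 => /eqP ->.
Qed.

End Goursat.

(** * Complex differentiability in real coordinates *)
Section ComplexPlane.
Variable R : realType.

Lemma linear_is_diff (V W : normedModType R) (f : V -> W) x :
  linear f -> continuous f -> is_diff x f f.
Proof.
move=> lf cf.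
pose fM := GRing.isLinear.Build _ _ _ _ _ lf.
pose fL : {linear V -> W} := HB.pack f fM.
by split; [exact: (@linear_differentiable _ _ _ fL)|rewrite (@diff_lin _ _ _ fL)].
Qed.

Lemma derive_is_diff (g : R -> R) (x d : R) :
  is_derive x 1 g d -> is_diff x g (fun h => h * d).
Proof.
move=> gd; have dg : derivable g x 1 by [].
split; first exact/derivable1_diffP.
by rewrite deriv1E// derive1E derive_val.
Qed.

Lemma is_diff_cst0 (V : normedModType R) (k : R) (x : V) :
  is_diff x (fun=> k) (fun=> 0 : R).
Proof. exact: is_diff_cst. Qed.

Lemma is_diff_fst (V W : normedModType R) (p : V * W) : is_diff p fst fst.
Proof. by apply: linear_is_diff => // x; exact: cvg_fst. Qed.

Lemma is_diff_snd (V W : normedModType R) (p : V * W) : is_diff p snd snd.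
Proof. by apply: linear_is_diff => // x; exact: cvg_snd. Qed.

Definition cre (z : Cn R 1) : R := z.1 ord0 ord0.
Definition cim (z : Cn R 1) : R := z.2 ord0 ord0.
Definition mkC (a b : R) : Cn R 1 := (const_mx a, const_mx b).

Lemma mkCK z : mkC (cre z) (cim z) = z.
Proof.
case: z => x y; rewrite /mkC /cre /cim /=; congr pair.
  by apply/rowP => i; rewrite mxE (ord1 i).
by apply/rowP => i; rewrite mxE (ord1 i).
Qed.

Lemma cre_mkC a b : cre (mkC a b) = a. Proof. by rewrite /cre mxE. Qed.
Lemma cim_mkC a b : cim (mkC a b) = b. Proof. by rewrite /cim mxE. Qed.

Lemma is_diff_cre z : is_diff z cre cre.
Proof.
apply: linear_is_diff; first by move=> k x y; rewrite /cre /= !mxE.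
move=> x; apply: (@continuous_comp _ _ _ fst (fun M : 'M[R]_(1,1) => M ord0 ord0)).
  exact: cvg_fst.
exact: coord_continuous.
Qed.

Lemma is_diff_cim z : is_diff z cim cim.
Proof.
apply: linear_is_diff; first by move=> k x y; rewrite /cim /= !mxE.
move=> x; apply: (@continuous_comp _ _ _ snd (fun M : 'M[R]_(1,1) => M ord0 ord0)).
  exact: cvg_snd.
exact: coord_continuous.
Qed.

Lemma mkCE a b : mkC a b = a *: mkC 1 0 + b *: mkC 0 1.
Proof.
rewrite /mkC; congr pair; apply/rowP => i; rewrite !mxE.
  by rewrite mulr1 mulr0 addr0.
by rewrite mulr1 mulr0 add0r.
Qed.

Lemma is_diff_mkC (V : normedModType R) (a b : V -> R) da db x :
  is_diff x a da -> is_diff x b db ->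
  is_diff x (fun t => mkC (a t) (b t)) (fun h => mkC (da h) (db h)).
Proof.
move=> Ha Hb.
have H (c dc : V -> R) (w : Cn R 1) : is_diff x c dc ->
    is_diff x (fun t => c t *: w) (fun h => dc h *: w).
  move=> Hc; split; first exact: differentiableZl.
  by rewrite diffZl// diff_val.
have D := is_diffD (H _ _ (mkC 1 0) Ha) (H _ _ (mkC 0 1) Hb).
have E f g : (fun t => mkC (f t) (g t)) =
    (fun t => f t *: mkC 1 0) + (fun t => g t *: mkC 0 1) :> (V -> Cn R 1).
  by apply/funext => t; rewrite mkCE.
by rewrite !E.
Qed.

Lemma norm_mkC a b : `|mkC a b| <= `|a| + `|b|.
Proof.
rewrite mkCE (le_trans (ler_normD _ _))// !normrZ.
have H (c d : R) : `|c| <= 1 -> `|d| <= 1 -> `|mkC c d| <= 1.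
  move=> c1 d1; rewrite prod_normE ge_max /=; apply/andP; split.
    by rewrite /Num.norm /= mx_normrE; apply: bigmax_le => // i _; rewrite mxE.
  by rewrite /Num.norm /= mx_normrE; apply: bigmax_le => // i _; rewrite mxE.
by rewrite lerD// ler_piMr// H ?normr1 ?normr0.
Qed.

Lemma is_diff_approx (V W : normedModType R) (f : V -> W) x df :
  is_diff x f df -> forall e, 0 < e -> exists2 d, 0 < d &
  forall h, `|h| < d -> `|f (x + h) - f x - df h| <= e * `|h|.
Proof.
move=> H e e0; have df0 : differentiable f x by [].
have := diff_locally df0; rewrite diff_val => /eqaddoP.
move=> /(_ e e0) /nbhs_ballP[d /= d0 Hd]; exists d => // h hd.
have := Hd h; rewrite -ball_normE /= sub0r normrN => /(_ hd).
by rewrite /= !fctE /= (addrC h) opprD addrA.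
Qed.

Lemma is_diff_closed_form (P Q : R * R -> R) p dP dQ :
  is_diff p P dP -> is_diff p Q dQ -> dQ (1, 0) = dP (0, 1) ->
  closed_form_at R (fun x y => P (x, y)) (fun x y => Q (x, y)) p.1 p.2.
Proof.
move=> HP HQ E.
have ld df : forall f, is_diff p f df -> forall h k,
    df (h, k) = df (1, 0) * h + df (0, 1) * k :> R.
  move=> f Hf h k.
  have -> : (h, k) = h *: (1, 0) + k *: (0, 1) :> R * R.
    congr pair; rewrite /= /GRing.scale/= ?mulr1 ?mulr0 ?addr0 ?add0r//.
  by rewrite -(@diff_val _ _ _ _ _ _ _ Hf) linearD !linearZ /= /GRing.scale/= ![_ * h]mulrC ![_ * k]mulrC.
exists (dP (1, 0)), (dP (0, 1)), (dQ (0, 1)) => e e0.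
have [d1 d10 H1] := is_diff_approx _ _ _ _ _ HP e e0.
have [d2 d20 H2] := is_diff_approx _ _ _ _ _ HQ e e0.
exists (Num.min d1 d2); first by rewrite lt_min d10.
move=> h k; rewrite !lt_min => /andP[h1 h2] /andP[k1 k2].
have nle : `|(h, k) : R * R| <= `|h| + `|k|.
  by rewrite prod_normE /= ge_max lerDl lerDr !normr_ge0.
have hk1 : `|(h, k) : R * R| < d1 by rewrite prod_normE gt_max h1.
have hk2 : `|(h, k) : R * R| < d2 by rewrite prod_normE gt_max h2.
have := H1 _ hk1; have := H2 _ hk2.
rewrite (ld _ _ HP) (ld _ _ HQ) E; case: p {HP HQ H1 H2 ld} => x y /= hQ hP.
split.
  by apply: le_trans hP _; rewrite ler_wpM2l// ltW.
by apply: le_trans hQ _; rewrite ler_wpM2l// ltW.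
Qed.

(* [u + i v] is complex differentiable at [z] with derivative [a + i b]. *)
Definition cderiv (u v : Cn R 1 -> R) z (a b : R) :=
  is_diff z u (fun h => a * cre h - b * cim h) /\
  is_diff z v (fun h => b * cre h + a * cim h).

(** The complex exponential: a vertical segment of length [2 pi] at abscissa [x] winds once around
    the circle of radius [exp x]. *)
Definition polar (x y : R) := mkC (expR x * cos y) (expR x * sin y).

Lemma is_diff_polar (p : R * R) :
  is_diff p (fun q => polar q.1 q.2)
   (fun h => mkC (expR p.1 * (h.1 * cos p.2 - h.2 * sin p.2))
                 (expR p.1 * (h.1 * sin p.2 + h.2 * cos p.2))).
Proof.
have e := is_diff_comp (is_diff_fst _ _ p) (derive_is_diff _ _ _ (is_derive_expR p.1)).
have c := is_diff_comp (is_diff_snd _ _ p) (derive_is_diff _ _ _ (is_derive_cos p.2)).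
have s := is_diff_comp (is_diff_snd _ _ p) (derive_is_diff _ _ _ (is_derive_sin p.2)).
apply: (is_diff_eq (is_diff_mkC _ _ _ _ _ _ (is_diffM e c) (is_diffM e s))).
by apply/funext => h; rewrite /= !fctE /=; congr mkC; rewrite /GRing.scale /=; ring.
Qed.

(* The real and imaginary parts of [1 - (w + w^-1) / 2] at [w = z / r], where
   [z = exp (x + i y)]; on the circle [|z| = r] this is [1 - cos y >= 0]. *)
Definition kerA (r : R) (p : R * R) :=
  1 - (expR p.1 / r + r * expR (- p.1)) / 2 * cos p.2.
Definition kerB (r : R) (p : R * R) :=
  (r * expR (- p.1) - expR p.1 / r) / 2 * sin p.2.

Lemma is_diff_ker r (p : R * R) :
  is_diff p (kerA r) (fun h =>
    (r * expR (- p.1) - expR p.1 / r) / 2 * cos p.2 * h.1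
    + (expR p.1 / r + r * expR (- p.1)) / 2 * sin p.2 * h.2) /\
  is_diff p (kerB r) (fun h =>
    - ((expR p.1 / r + r * expR (- p.1)) / 2 * sin p.2) * h.1
    + (r * expR (- p.1) - expR p.1 / r) / 2 * cos p.2 * h.2).
Proof.
have d1 : is_derive p.1 1 (fun x : R => (expR x / r + r * expR (- x)) / 2)
    ((expR p.1 / r - r * expR (- p.1)) / 2).
  apply: is_derive_eq; rewrite /= /GRing.scale/=; ring.
have d2 : is_derive p.1 1 (fun x : R => (r * expR (- x) - expR x / r) / 2)
    (- ((expR p.1 / r + r * expR (- p.1)) / 2)).
  apply: is_derive_eq; rewrite /= /GRing.scale/=; ring.
have e1 := is_diff_comp (is_diff_fst _ _ p) (derive_is_diff _ _ _ d1).
have e2 := is_diff_comp (is_diff_fst _ _ p) (derive_is_diff _ _ _ d2).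
have c := is_diff_comp (is_diff_snd _ _ p) (derive_is_diff _ _ _ (is_derive_cos p.2)).
have s := is_diff_comp (is_diff_snd _ _ p) (derive_is_diff _ _ _ (is_derive_sin p.2)).
split.
  apply: (is_diff_eq (is_diffB (is_diff_cst0 _ 1 p) (is_diffM e1 c))).
  by apply/funext => h; rewrite /= !fctE /= /GRing.scale /=; ring.
apply: (is_diff_eq (is_diffM e2 s)).
by apply/funext => h; rewrite /= !fctE /= /GRing.scale /=; ring.
Qed.

Section Core.
Variables (u v : Cn R 1 -> R) (r : R).

(** Let [F] be the product of [u + i v], minus its value at 0, with the kernel [kerA + i kerB]. Then
    [formQ] is [Re F] and [formP] is [Im F], so that [formP dx + formQ dy] is the imaginary part of
    [F d(x + i y)]. *)
Definition formP (p : R * R) :=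
  (u (polar p.1 p.2) - u 0) * kerB r p + (v (polar p.1 p.2) - v 0) * kerA r p.
Definition formQ (p : R * R) :=
  (u (polar p.1 p.2) - u 0) * kerA r p - (v (polar p.1 p.2) - v 0) * kerB r p.

Lemma form_closed (x y a b : R) :
  cderiv u v (polar x y) a b ->
  closed_form_at R (fun x y => formP (x, y)) (fun x y => formQ (x, y)) x y.
Proof.
move=> [Hu Hv]; pose p := (x, y).
have [kA kB] := is_diff_ker r p.
have U := is_diffB (is_diff_comp (is_diff_polar p) Hu) (is_diff_cst0 _ (u 0) p).
have V := is_diffB (is_diff_comp (is_diff_polar p) Hv) (is_diff_cst0 _ (v 0) p).
have D1 := is_diffD (is_diffM U kB) (is_diffM V kA).
have D2 := is_diffB (is_diffM U kA) (is_diffM V kB).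
apply: (is_diff_closed_form formP formQ p _ _ D1 D2).
rewrite /= !fctE /= !cre_mkC !cim_mkC /GRing.scale /=; ring.
Qed.

End Core.

End ComplexPlane.

(** * The derivative bound for maps into a half-plane *)
Section HalfPlane.
Variable R : realType.
Implicit Types u v : Cn R 1 -> R.

Lemma enorm1E (z : Cn R 1) : enorm z = Num.sqrt (cre R z ^+ 2 + cim R z ^+ 2).
Proof. by rewrite /enorm big_ord_recl big_ord0 addr0. Qed.

Lemma enorm_polar x y : enorm (polar R x y) = expR x.
Proof.
rewrite enorm1E cre_mkC cim_mkC !exprMn -mulrDr cos2Dsin2 mulr1.
by rewrite sqrtr_sqr ger0_norm// expR_ge0.
Qed.

Lemma itv_int_1Bcos (k : R) :
  itv_int R (fun y => k * (1 - cos y)) 0 (pi *+ 2) = k * (pi *+ 2).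
Proof.
have p0 : 0 < pi *+ 2 :> R by rewrite mulrn_wgt0// pi_gt0.
have dF (x : R) : is_derive x 1 (fun y : R => k * (y - sin y)) (k * (1 - cos x)).
  by apply: is_derive_eq; rewrite /= /GRing.scale/=; ring.
have cF : continuous (fun y : R => k * (y - sin y)).
  move=> x; apply: differentiable_continuous; apply/derivable1_diffP.
  by have [] := dF x.
have cf : continuous (fun y : R => k * (1 - cos y)).
  move=> x; apply: differentiable_continuous; apply/derivable1_diffP.
  by apply: ex_derive.
rewrite /itv_int /Rintegral.
rewrite (continuous_FTC2 (F := fun y : R => k * (y - sin y)) p0).
- by rewrite /= sin2pi sin0 !subr0 mulr0 subr0.
- exact: continuous_subspaceT.
- split; first by move=> x _; have [] := dF x.
    exact: cvg_at_right_filter (cF 0).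
  exact: cvg_at_left_filter (cF _).
- by move=> x _; rewrite derive1E; have [_ ->] := dF x.
Qed.

(** Here [c] and [n] stand for the cosine and sine of a point on the circle of radius [s], and [e1],
    [e2] for the first-order errors of [u] and [v]. The kernel has the polar part [- r / (2 z)] at
    the origin and is multiplied by a function close to [(a + i b) z], which leaves [- r * a / 2] in
    the real part. *)
Lemma kernel_near_pole (a b r s c n e e1 e2 : R) :
  0 < s -> s <= r -> r <= 1 -> 0 <= e -> c ^+ 2 + n ^+ 2 = 1 ->
  `|e1| <= e * (2 * s) -> `|e2| <= e * (2 * s) ->
  `|(s * (a * c - b * n) + e1) * (1 - (s / r + r * s^-1) / 2 * c)
    - (s * (b * c + a * n) + e2) * ((r * s^-1 - s / r) / 2 * n) - (- (r * a / 2))|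
  <= 2 * (`|a| + `|b|) * s + 6 * e.
Proof.
move=> s0 sr r1 e0 cn H1 H2.
have r0 : 0 < r := lt_le_trans s0 sr.
have c1 : `|c| <= 1.
  rewrite -(@ler_pXn2r _ 2)// ?nnegrE// expr1n real_normK ?num_real// -cn lerDl.
  exact: sqr_ge0.
have n1 : `|n| <= 1.
  rewrite -(@ler_pXn2r _ 2)// ?nnegrE// expr1n real_normK ?num_real// -cn lerDr.
  exact: sqr_ge0.
(* Multiplied by [s], the kernel coefficients split into a bounded part [r / 2] from the pole and a
   small part [q]. *)
pose q := s / r * (s / 2).
have q0 : 0 <= q by rewrite /q mulr_ge0 ?divr_ge0 ?ltW.
have qs : q <= s / 2.
  by rewrite /q ler_piMl//; [rewrite divr_ge0// ltW|rewrite ler_pdivrMr// mul1r].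
pose f1 := e1 / s; pose f2 := e2 / s.
have E1 : e1 = f1 * s by rewrite /f1 divfK// gt_eqF.
have E2 : e2 = f2 * s by rewrite /f2 divfK// gt_eqF.
have F1 : `|f1| <= 2 * e.
  by rewrite /f1 normrM normfV (gtr0_norm s0) ler_pdivrMr//; lra.
have F2 : `|f2| <= 2 * e.
  by rewrite /f2 normrM normfV (gtr0_norm s0) ler_pdivrMr//; lra.
rewrite (_ : (_ - _) - _ = (a * c - b * n) * (s - q * c)
    + (b * c + a * n) * (q * n) + f1 * (s - q * c - r / 2 * c)
    - f2 * ((r / 2 - q) * n)); last first.
  have -> : r * a / 2 = r * a / 2 * (c ^+ 2 + n ^+ 2) by rewrite cn mulr1.
  by rewrite E1 E2 /q; field; rewrite !gt_eqF.
have qc : `|q * c| <= q by rewrite normrM ger0_norm// ler_piMr.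
have qn : `|q * n| <= q by rewrite normrM ger0_norm// ler_piMr.
have rc : `|r / 2 * c| <= r / 2.
  have r2 : 0 <= r / 2 by rewrite divr_ge0 ?ltW.
  by rewrite normrM ger0_norm// ler_piMr.
have A1 : `|a * c - b * n| <= `|a| + `|b|.
  by rewrite (le_trans (ler_normB _ _))// !normrM lerD// ler_piMr.
have A2 : `|b * c + a * n| <= `|a| + `|b|.
  by rewrite addrC (le_trans (ler_normD _ _))// !normrM lerD// ler_piMr.
have B1 : `|(a * c - b * n) * (s - q * c)| <= (`|a| + `|b|) * (s + q).
  rewrite normrM ler_pM// (le_trans (ler_normB _ _))// (gtr0_norm s0).
  by rewrite lerD2l.
have B2 : `|(b * c + a * n) * (q * n)| <= (`|a| + `|b|) * q.
  by rewrite normrM ler_pM.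
have B3 : `|f1 * (s - q * c - r / 2 * c)| <= 2 * e * (s + q + r / 2).
  rewrite normrM ler_pM// (le_trans (ler_normB _ _))// lerD//.
  by rewrite (le_trans (ler_normB _ _))// (gtr0_norm s0) lerD2l.
have B4 : `|f2 * ((r / 2 - q) * n)| <= 2 * e * (r / 2 - q).
  have rq : 0 <= r / 2 - q by lra.
  by rewrite normrM ler_pM// normrM ger0_norm// ler_piMr.
rewrite (le_trans (ler_normB _ _))//.
apply: (@le_trans _ _ ((`|a| + `|b|) * (s + q) + (`|a| + `|b|) * q
   + 2 * e * (s + q + r / 2) + 2 * e * (r / 2 - q))).
  rewrite lerD// (le_trans (ler_normD _ _))// lerD//.
  by rewrite (le_trans (ler_normD _ _))// lerD.
have ab0 : 0 <= `|a| + `|b| by rewrite addr_ge0.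
have T1 : (`|a| + `|b|) * (s + q + q) <= (`|a| + `|b|) * (2 * s).
  by rewrite ler_wpM2l//; lra.
have T2 : e * (s + r) <= e * 2 by rewrite ler_wpM2l//; lra.
lra.
Qed.

(** The integral of [formQ] is the same over the circle of radius [r], where positivity of [u]
    bounds it from below, and over a small circle, where it is close to [- (r * a / 2) * 2 pi]. *)
Lemma half_plane_deriv_circle u v a b r : 0 < r -> r < 1 ->
  (forall z, enorm z < 1 -> 0 <= u z /\ exists a b, cderiv R u v z a b) ->
  cderiv R u v 0 a b -> r * a <= 2 * u 0.
Proof.
move=> r0 r1 H [Hu Hv].
pose P x y := formP R u v r (x, y); pose Q x y := formQ R u v r (x, y).
have p0 : 0 < pi *+ 2 :> R by rewrite mulrn_wgt0// pi_gt0.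
have cf x y : x <= ln r -> closed_form_at R P Q x y.
  move=> xr; have : enorm (polar R x y) < 1.
    by rewrite enorm_polar (le_lt_trans _ r1)// -[leRHS](lnK r0) ler_expR.
  by case/H => _ [a' [b' Hab]]; apply: form_closed Hab.
(* On this circle [kerB] vanishes and [kerA] is [1 - cos y >= 0], so the integrand is at least
   [- u 0 * (1 - cos y)]. *)
have lower : - u 0 * (pi *+ 2) <= itv_int R (Q (ln r)) 0 (pi *+ 2).
  rewrite -itv_int_1Bcos; apply: le_itv_int.
  - move=> y _; apply: differentiable_continuous; apply/derivable1_diffP.
    by apply: ex_derive.
  - by move=> y _; have [] := closed_form_continuous _ _ _ _ _ (cf (ln r) y (lexx _)).
  move=> y _; rewrite /Q /formQ /kerA /kerB /= expRN (lnK r0).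
  rewrite divff ?gt_eqF// mulfV ?gt_eqF// subrr mul0r mul0r mulr0 subr0.
  rewrite mul1r ler_wpM2r ?subr_ge0 ?cos_le1//.
  rewrite lerDr; apply: (H _ _).1.
  by rewrite enorm_polar lnK.
rewrite -ler_pdivlMl//; apply/ler_addgt0Pr => eta eta0.
pose m := `|a| + `|b|.
have m0 : 0 <= m by rewrite addr_ge0.
have e0 : 0 < r * eta / 24 by rewrite divr_gt0// mulr_gt0.
have [d1 d10 H1] := is_diff_approx _ _ _ _ _ _ Hu _ e0.
have [d2 d20 H2] := is_diff_approx _ _ _ _ _ _ Hv _ e0.
(* Points of the circle have ambient norm at most [2 * s], hence lie where both expansions hold. The
   last bound gives [2 * m * s <= r * eta / 4], and the expansion error contributes
   [6 * (r * eta / 24) = r * eta / 4]. *)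
pose s := Num.min (Num.min (d1 / 3) (d2 / 3)) (Num.min r (r * eta / (8 * (m + 1)))).
have m1 : 0 < 8 * (m + 1) by lra.
have s0 : 0 < s by rewrite /s !lt_min !divr_gt0 ?r0//= mulr_gt0.
have sd1 : s <= d1 / 3 by rewrite /s !ge_min lexx.
have sd2 : s <= d2 / 3 by rewrite /s !ge_min lexx orbT.
have sr : s <= r by rewrite /s !ge_min lexx !orbT.
have sm : s * (8 * (m + 1)) <= r * eta.
  by rewrite -ler_pdivlMr// /s !ge_min lexx !orbT.
have lsr : ln s <= ln r by rewrite ler_ln.
have := goursat_periodic R P Q (ln s) (ln r) 0 (pi *+ 2) lsr (ltW p0).
have cl x y : ln s <= x <= ln r -> 0 <= y <= pi *+ 2 -> closed_form_at R P Q x y.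
  by case/andP => _ xr _; exact: cf.
have per x : P x 0 = P x (pi *+ 2).
  rewrite /P /formP /polar /kerA /kerB /=.
  by rewrite cos2pi sin2pi cos0 sin0.
move=> /(_ cl per) Eq; move: lower; rewrite -Eq.
have : `|itv_int R (Q (ln s)) 0 (pi *+ 2) - - (r * a / 2) * (pi *+ 2 - 0)| <=
    (r * eta / 2) * (pi *+ 2 - 0).
  apply: itv_int_near; first exact: ltW.
    by move=> y _; have [] := closed_form_continuous _ _ _ _ _ (cf (ln s) y lsr).
  move=> y _; pose h := polar R (ln s) y.
  have nh : `|h| <= 2 * s.
    rewrite (le_trans (norm_mkC _ _ _))// !normrM lnK ?posrE// (gtr0_norm s0).
    have := ler_wpM2l (ltW s0) (cos_max y); have := ler_wpM2l (ltW s0) (sin_max y).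
    by lra.
  have hd1 : `|h| < d1 by lra.
  have hd2 : `|h| < d2 by lra.
  have := H1 h hd1; have := H2 h hd2; rewrite add0r !cre_mkC !cim_mkC !lnK//.
  set e2 := v h - _ - _; set e1 := u h - _ - _ => h2 h1.
  have -> : Q (ln s) y = (s * (a * cos y - b * sin y) + e1)
      * (1 - (s / r + r * s^-1) / 2 * cos y)
    - (s * (b * cos y + a * sin y) + e2) * ((r * s^-1 - s / r) / 2 * sin y).
    rewrite /Q /formQ /kerA /kerB /= expRN (lnK s0) -/h /e1 /e2.
    by congr (_ * _ - _ * _); ring.
  have ee : 0 <= r * eta / 24 by apply: ltW.
  have h1' : `|e1| <= r * eta / 24 * (2 * s).
    by apply: le_trans h1 _; rewrite ler_wpM2l.
  have h2' : `|e2| <= r * eta / 24 * (2 * s).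
    by apply: le_trans h2 _; rewrite ler_wpM2l.
  apply: le_trans (kernel_near_pole _ _ _ _ _ _ _ _ _ s0 sr (ltW r1) ee
     (cos2Dsin2 y) h1' h2') _.
  by move: sm; rewrite -/m; lra.
rewrite subr0 ler_norml => /andP[_ up] lo.
have {up lo} : - u 0 * (pi *+ 2) <= (- (r * a / 2) + r * eta / 2) * (pi *+ 2) by lra.
rewrite ler_pM2r// -(ler_pM2l r0 a) mulrDr mulVKf ?gt_eqF//; lra.
Qed.

Lemma half_plane_deriv u v a b :
  (forall z, enorm z < 1 -> 0 <= u z /\ exists a b, cderiv R u v z a b) ->
  cderiv R u v 0 a b -> a <= 2 * u 0.
Proof.
move=> H Hab.
have [a0|a0] := leP a 0.
  rewrite (le_trans a0)// mulr_ge0//; apply: (H 0 _).1.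
  by rewrite enorm1E /cre /cim !mxE expr0n addr0 sqrtr0.
rewrite leNgt; apply/negP => h.
have u0 : 0 <= 2 * u 0.
  rewrite mulr_ge0//; apply: (H 0 _).1.
  by rewrite enorm1E /cre /cim !mxE expr0n addr0 sqrtr0.
(* Instead of a limit [r -> 1]: this radius makes [r * a] the midpoint of [2 * u 0] and [a], which
   contradicts the bound on the circle if [2 * u 0 < a]. *)
pose r := (2 * u 0 + a) / (2 * a).
have a2 : 0 < 2 * a by lra.
have r0 : 0 < r by rewrite divr_gt0//; lra.
have r1 : r < 1 by rewrite ltr_pdivrMr//; lra.
have := half_plane_deriv_circle u v a b r r0 r1 H Hab.
have -> : r * a = (2 * u 0 + a) / 2 by rewrite /r; field; rewrite gt_eqF.
lra.
Qed.

End HalfPlane.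

(** * Half-spaces in C^n *)
Section HermitianSpace.
Variable R : realType.

(** The real part of the Hermitian product; its imaginary part is [ip x (Jc y)]. *)
Definition ip n (x y : Cn R n) : R :=
  \sum_(i < n) (x.1 ord0 i * y.1 ord0 i + x.2 ord0 i * y.2 ord0 i).

Variable n : nat.
Implicit Types x y z : Cn R n.

Lemma ipC x y : ip n x y = ip n y x.
Proof. by apply: eq_bigr => i _; congr (_ + _); rewrite mulrC. Qed.

Lemma ipDl x y z : ip n (x + y) z = ip n x z + ip n y z.
Proof. by rewrite -big_split; apply: eq_bigr => i _; rewrite /= !mxE; ring. Qed.

Lemma ipZl k x z : ip n (k *: x) z = k * ip n x z.
Proof. by rewrite mulr_sumr; apply: eq_bigr => i _; rewrite /= !mxE; ring. Qed.

Lemma ipNl x z : ip n (- x) z = - ip n x z.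
Proof. by rewrite -scaleN1r ipZl mulN1r. Qed.

Lemma ipBl x y z : ip n (x - y) z = ip n x z - ip n y z.
Proof. by rewrite ipDl ipNl. Qed.

Lemma ipZr k x z : ip n x (k *: z) = k * ip n x z.
Proof. by rewrite ipC ipZl ipC. Qed.

Lemma ipDr x y z : ip n x (y + z) = ip n x y + ip n x z.
Proof. by rewrite ipC ipDl !(ipC x). Qed.

Lemma ipNr x z : ip n x (- z) = - ip n x z.
Proof. by rewrite ipC ipNl ipC. Qed.

Lemma ipBr x y z : ip n x (y - z) = ip n x y - ip n x z.
Proof. by rewrite ipDr ipNr. Qed.

Lemma JcE x : Jc x = (- x.2, x.1).
Proof. by rewrite /Jc /Defs.cscale !scale0r !scale1r sub0r add0r. Qed.

Lemma ipJl x y : ip n (Jc x) y = - ip n x (Jc y).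
Proof.
rewrite !JcE /ip -sumrN; apply: eq_bigr => i _; rewrite /= !mxE; ring.
Qed.

Lemma ipJJ x y : ip n (Jc x) (Jc y) = ip n x y.
Proof. by rewrite !JcE; apply: eq_bigr => i _; rewrite /= !mxE; ring. Qed.

Lemma ipJ x : ip n x (Jc x) = 0.
Proof. by rewrite !JcE; apply: big1 => i _; rewrite /= !mxE; ring. Qed.

Lemma cscaleE a b x : Defs.cscale a b x = a *: x + b *: Jc x.
Proof. by rewrite JcE /Defs.cscale; congr pair; rewrite /= scalerN. Qed.

Lemma ip_ge0 x : 0 <= ip n x x.
Proof. by apply: sumr_ge0 => i _; rewrite addr_ge0// -expr2 sqr_ge0. Qed.

Lemma enormE x : enorm x = Num.sqrt (ip n x x).
Proof. by []. Qed.

Lemma enorm_ge0 x : 0 <= enorm x.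
Proof. exact: sqrtr_ge0. Qed.

Lemma enorm_sqr x : enorm x ^+ 2 = ip n x x.
Proof. by rewrite enormE sqr_sqrtr// ip_ge0. Qed.

(** The ambient norm is the maximum of the absolute values of the real coordinates. This comparison
    places Euclidean balls inside topological neighbourhoods. *)
Lemma normr_le_enorm x : `|x| <= enorm x.
Proof.
have H i : x.1 ord0 i ^+ 2 + x.2 ord0 i ^+ 2 <= enorm x ^+ 2.
  rewrite enorm_sqr /ip (bigD1 i)//= -!expr2 lerDl; apply: sumr_ge0 => j _.
  by rewrite addr_ge0// -expr2 sqr_ge0.
rewrite prod_normE ge_max; apply/andP; split.
  rewrite /Num.norm /= mx_normrE; apply: bigmax_le; first exact: enorm_ge0.
  move=> [i j] _; rewrite /= (ord1 i) -(@ler_pXn2r _ 2)// ?nnegrE ?enorm_ge0//.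
  by rewrite real_normK ?num_real// (le_trans _ (H j))// lerDl sqr_ge0.
rewrite /Num.norm /= mx_normrE; apply: bigmax_le; first exact: enorm_ge0.
move=> [i j] _; rewrite /= (ord1 i) -(@ler_pXn2r _ 2)// ?nnegrE ?enorm_ge0//.
by rewrite real_normK ?num_real// (le_trans _ (H j))// lerDr sqr_ge0.
Qed.

Lemma enorm_eq0 x : enorm x = 0 -> x = 0.
Proof.
by move=> x0; apply/eqP; rewrite -normr_eq0 -normr_le0 normr_id -x0 normr_le_enorm.
Qed.

Lemma cauchy_schwarz x y : ip n x y <= enorm x * enorm y.
Proof.
have [y0|y0] := eqVneq (enorm y) 0.
  rewrite y0 mulr0 (enorm_eq0 _ y0) -(scale0r x) ipC ipZl mul0r//.
have yy : 0 < ip n y y by rewrite -enorm_sqr exprn_gt0// lt_def y0 enorm_ge0.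
have := ip_ge0 (ip n y y *: x - ip n x y *: y).
rewrite !(ipBl, ipBr, ipZl, ipZr) (ipC y x) => h.
have {}h : 0 <= ip n y y * (ip n y y * ip n x x - ip n x y ^+ 2).
  by apply: le_trans h _; rewrite le_eqVlt; apply/orP; left; apply/eqP; ring.
rewrite pmulr_rge0// subr_ge0 in h.
have [xy|/ltW xy] := leP 0 (ip n x y); last first.
  by rewrite (le_trans xy)// mulr_ge0// enorm_ge0.
rewrite -(@ler_pXn2r _ 2)// ?nnegrE ?mulr_ge0 ?enorm_ge0//.
by rewrite exprMn !enorm_sqr mulrC.
Qed.

Lemma enormZ k x : enorm (k *: x) = `|k| * enorm x.
Proof.
by rewrite !enormE ipZl ipZr mulrA -expr2 sqrtrM ?sqr_ge0// sqrtr_sqr.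
Qed.

Lemma enormN x : enorm (- x) = enorm x.
Proof. by rewrite -scaleN1r enormZ normrN1 mul1r. Qed.

Lemma enorm0 : enorm (0 : Cn R n) = 0.
Proof. by rewrite -(scale0r (0 : Cn R n)) enormZ normr0 mul0r. Qed.

Lemma enormB x y : enorm (x - y) = enorm (y - x).
Proof. by rewrite -enormN opprB. Qed.

Lemma ler_enormD x y : enorm (x + y) <= enorm x + enorm y.
Proof.
rewrite -(@ler_pXn2r _ 2)// ?nnegrE ?addr_ge0 ?enorm_ge0//.
rewrite enorm_sqr sqrrD !enorm_sqr !(ipDl, ipDr) (ipC y x).
have := cauchy_schwarz x y; rewrite mulr2n; lra.
Qed.

Lemma ler_enorm_dist x y z : enorm (x - z) <= enorm (x - y) + enorm (y - z).
Proof. by rewrite (le_trans _ (ler_enormD _ _))// addrA subrK. Qed.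

Lemma enorm_cscale a b x : enorm (Defs.cscale a b x) = Num.sqrt (a ^+ 2 + b ^+ 2) * enorm x.
Proof.
rewrite cscaleE !enormE !(ipDl, ipDr, ipZl, ipZr) ipJJ (ipC (Jc x)) ipJ.
rewrite -sqrtrM ?addr_ge0 ?sqr_ge0//; congr Num.sqrt; ring.
Qed.

Lemma is_diff_ip e x : is_diff x (fun y => ip n y e) (fun y => ip n y e).
Proof.
apply: linear_is_diff; first by move=> k u w; rewrite ipDl ipZl.
have H (g : Cn R n -> 'rV[R]_n) (i : 'I_n) (c : R) : continuous g ->
    continuous (fun z => g z ord0 i * c).
  move=> cg z; apply: cvgMl.
  apply: (@continuous_comp _ _ _ g (fun M : 'rV[R]_n => M ord0 i)); first exact: cg.
  exact: coord_continuous.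
apply: continuous_big; first exact: add_continuous.
by move=> i _ y; apply: cvgD; apply: H => z; [exact: cvg_fst|exact: cvg_snd].
Qed.

End HermitianSpace.

(** * Scalar components of holomorphic maps and directional derivative bounds *)

Section Holomorphic.
Variable R : realType.

(** Pairing with [e] and with [Jc e] gives the real and imaginary parts of the scalar holomorphic
    function obtained from the Hermitian product with [e]. *)
Lemma holomorphic_cderiv n (f : Cn R 1 -> Cn R n) z e :
  differentiable f z -> (forall h, 'd f z (Jc h) = Jc ('d f z h)) ->
  cderiv R (fun w => ip R n (f w) e) (fun w => ip R n (f w) (Jc e)) z
    (ip R n ('d f z (mkC R 1 0)) e) (ip R n ('d f z (mkC R 1 0)) (Jc e)).
Proof.
move=> df CR; have {}df := differentiableP df.
have E h : 'd f z h = cre R h *: 'd f z (mkC R 1 0) + cim R h *: Jc ('d f z (mkC R 1 0)).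
  rewrite -CR -!linearZ -linearD /=; congr ('d f z _).
  rewrite -[LHS]mkCK mkCE JcE; congr (_ + _ *: _).
  by rewrite /mkC; congr pair; apply/rowP => i; rewrite !mxE ?oppr0.
split; apply: (is_diff_eq (is_diff_comp df (is_diff_ip _ _ _ _))).
  by apply/funext => h; rewrite /= E ipDl !ipZl ipJl; ring.
by apply/funext => h; rewrite /= E ipDl !ipZl ipJJ; ring.
Qed.

Lemma holomorphic_comp m n p (f : Cn R n -> Cn R p) (g : Cn R m -> Cn R n)
    (U : set (Cn R m)) (V : set (Cn R n)) :
  holomorphic_on g U -> holomorphic_on f V -> (forall z, U z -> V (g z)) ->
  holomorphic_on (f \o g) U.
Proof.
move=> hg hf UV z Uz; have [dg Cg] := hg z Uz; have [df Cf] := hf _ (UV z Uz).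
split; first exact: differentiable_comp.
by move=> h; rewrite diff_comp//= Cg Cf.
Qed.

Lemma half_plane_bound n (f df : Cn R 1 -> Cn R n) e c :
  holomorphic_on f (unit_disc (R := R)) ->
  (forall z, unit_disc z -> ip R n (f z) e <= c) ->
  is_diff (0 : Cn R 1) f df ->
  - ip R n (df (mkC R 1 0)) e <= 2 * (c - ip R n (f 0) e).
Proof.
move=> hf fc Hdf; rewrite -(@diff_val _ _ _ _ _ _ _ Hdf).
have D z : unit_disc z -> cderiv R (fun w => c - ip R n (f w) e)
    (fun w => - ip R n (f w) (Jc e)) z
    (- ip R n ('d f z (mkC R 1 0)) e) (- ip R n ('d f z (mkC R 1 0)) (Jc e)).
  move=> Dz; have [dfz CR] := hf z Dz.
  have [Hu Hv] := holomorphic_cderiv n f z e dfz CR.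
  split.
    apply: (is_diff_eq (is_diffB (is_diff_cst0 _ _ c z) Hu)).
    by apply/funext => h; rewrite !fctE /=; ring.
  apply: (is_diff_eq (is_diffN Hv)).
  by apply/funext => h; rewrite !fctE /=; ring.
apply: (half_plane_deriv R (fun w => c - ip R n (f w) e)
  (fun w => - ip R n (f w) (Jc e)) _ _ _ (D 0 _)).
  move=> z Dz; split; first by rewrite subr_ge0 fc.
  by eexists; eexists; exact: D.
by rewrite /unit_disc /= enorm0.
Qed.

Definition affC (z w h : Cn R 1) : Cn R 1 := z + Defs.cscale (cre R h) (cim R h) w.

Lemma is_diff_affC z w x :
  is_diff x (affC z w) (fun h => Defs.cscale (cre R h) (cim R h) w).
Proof.
have E : affC z w = (fun=> z) + (fun h => cre R h *: w) + (fun h => cim R h *: Jc w).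
  by apply/funext => h; rewrite /affC cscaleE !fctE addrA.
have H (c : Cn R 1 -> R) (v : Cn R 1) : is_diff x c c ->
    is_diff x (fun t => c t *: v) (fun h => c h *: v).
  move=> Hc; split; first exact: differentiableZl.
  by rewrite diffZl// diff_val.
have Ha := H _ w (is_diff_cre R x); have Hb := H _ (Jc w) (is_diff_cim R x).
have Hc : is_diff x (fun=> z) (fun=> 0 : Cn R 1) by exact: is_diff_cst.
have D := is_diffD (is_diffD Hc Ha) Hb.
rewrite E; apply: (is_diff_eq D).
by apply/funext => h; rewrite cscaleE !fctE add0r.
Qed.

Lemma cre0 : cre R 0 = 0. Proof. by rewrite /cre mxE. Qed.
Lemma cim0 : cim R 0 = 0. Proof. by rewrite /cim mxE. Qed.

Lemma cre_Jc h : cre R (Jc h) = - cim R h.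
Proof. by rewrite JcE /cre mxE. Qed.

Lemma cim_Jc h : cim R (Jc h) = cre R h.
Proof. by rewrite JcE. Qed.

Lemma Jc_cscale n a b (w : Cn R n) : Jc (Defs.cscale a b w) = Defs.cscale (- b) a w.
Proof.
rewrite JcE /Defs.cscale /=; congr pair; last by rewrite scaleNr addrC.
by rewrite scaleNr opprD addrC.
Qed.

Lemma holomorphic_affC z w U : holomorphic_on (affC z w) U.
Proof.
move=> x _; have H := is_diff_affC z w x; split; first by [].
by move=> h; rewrite !diff_val cre_Jc cim_Jc Jc_cscale.
Qed.

(** Precomposing [f] with the affine disc [h |-> z0 + h w], which stays in the ball of radius [rho],
    reduces this to the half-plane bound at the origin. *)
Lemma directional_bound n (f : Cn R 1 -> Cn R n) U z0 rho w e c :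
  holomorphic_on f U -> enorm w <= rho -> 0 < rho ->
  (forall z, enorm (z - z0) < rho -> U z /\ ip R n (f z) e <= c) ->
  - ip R n ('d f z0 w) e <= 2 * (c - ip R n (f z0) e).
Proof.
move=> hf wr r0 H.
have aU z : unit_disc z -> enorm (affC z0 w z - z0) < rho.
  rewrite /unit_disc /= /affC addrAC subrr add0r enorm_cscale -enorm1E => z1.
  by have := enorm_ge0 _ _ w; have := enorm_ge0 _ _ z; nra.
have hfa : holomorphic_on (f \o affC z0 w) (unit_disc (R := R)).
  apply: holomorphic_comp (holomorphic_affC z0 w _) hf _ => z /aU /H[]//.
have a0 : affC z0 w 0 = z0.
  by rewrite /affC cre0 cim0 cscaleE !scale0r !addr0.
have fc z : unit_disc z -> ip R n ((f \o affC z0 w) z) e <= c.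
  by move=> /aU /H[].
have Uz0 : U z0 by apply: (H _ _).1; rewrite subrr enorm0.
have [df _] := hf z0 Uz0.
have Df : is_diff (affC z0 w 0) f ('d f z0) by rewrite a0; exact: differentiableP.
have := half_plane_bound n _ _ e c hfa fc (is_diff_comp (is_diff_affC z0 w 0) Df).
rewrite /comp a0 cre_mkC cim_mkC cscaleE scale1r scale0r addr0.
exact.
Qed.

Lemma line_derive n (f : Cn R 1 -> Cn R n) w e (t : R) :
  differentiable f (t *: w) ->
  is_derive t 1 (fun s : R => ip R n (f (s *: w)) e) (ip R n ('d f (t *: w) w) e).
Proof.
move=> df.
have D : is_diff t (fun s : R => s *: w) (fun s : R => s *: w).
  exact: is_diff_scalel.
have D2 := is_diff_comp (is_diff_comp D (differentiableP df)) (is_diff_ip _ _ e _).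
have D3 : differentiable (fun s : R => ip R n (f (s *: w)) e) t by exact: (@ex_diff _ _ _ _ _ _ _ D2).
split; first exact/derivable1_diffP.
by rewrite deriveE// (@diff_val _ _ _ _ _ _ _ D2) /= scale1r.
Qed.

End Holomorphic.

(** * Harnack and Lipschitz estimates on the disc *)
Section Harnack.
Variable R : realType.

Section Mobius.
Variable al : R.

Definition mobD (w : Cn R 1) : R :=
  (1 + al * cre R w) ^+ 2 + (al * cim R w) ^+ 2.
Definition mobX (w : Cn R 1) : R :=
  (cre R w + al) * (1 + al * cre R w) + al * cim R w ^+ 2.
Definition mobY (w : Cn R 1) : R := (1 - al ^+ 2) * cim R w.

(* The Moebius map [w |-> (w + al) / (1 + al w)], split into real and imaginary parts. *)
Definition mobius (w : Cn R 1) : Cn R 1 :=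
  mkC R (mobX w / mobD w) (mobY w / mobD w).

Hypotheses (al0 : 0 <= al) (al1 : al < 1).

Lemma enorm_lt1 (w : Cn R 1) : (enorm w < 1) = (cre R w ^+ 2 + cim R w ^+ 2 < 1).
Proof.
by rewrite enorm1E -[X in _ < X = _]sqrtr1 ltr_sqrt.
Qed.

Lemma mobD_gt0 w : unit_disc w -> 0 < mobD w.
Proof.
rewrite /unit_disc /= enorm_lt1 /mobD.
set x := cre R w; set y := cim R w => xy.
have x1 : -1 < x.
  by rewrite ltNge; apply/negP => h; have := sqr_ge0 y; nra.
have h : 0 < 1 + al * x.
  have x2 : 0 <= x + 1 by lra.
  by have := mulr_ge0 al0 x2; move: al1; lra.
by rewrite ltr_pwDl ?sqr_ge0// exprn_gt0.
Qed.

Lemma mobius_disc w : unit_disc w -> unit_disc (mobius w).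
Proof.
move=> Dw; have D0 := mobD_gt0 w Dw; move: Dw.
rewrite /unit_disc /= !enorm_lt1 /mobius cre_mkC cim_mkC.
set x := cre R w; set y := cim R w => xy.
have -> : (mobX w / mobD w) ^+ 2 + (mobY w / mobD w) ^+ 2 =
    ((x + al) ^+ 2 + y ^+ 2) / mobD w.
  have D1 : mobD w != 0 by rewrite gt_eqF.
  have -> : (mobX w / mobD w) ^+ 2 + (mobY w / mobD w) ^+ 2 =
    (mobX w ^+ 2 + mobY w ^+ 2) / mobD w ^+ 2 by field.
  have -> : mobX w ^+ 2 + mobY w ^+ 2 = ((x + al) ^+ 2 + y ^+ 2) * mobD w.
    by rewrite /mobX /mobY /mobD -/x -/y; ring.
  by field.
rewrite ltr_pdivrMr// mul1r /mobD -/x -/y -subr_gt0.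
have -> : (1 + al * x) ^+ 2 + (al * y) ^+ 2 - ((x + al) ^+ 2 + y ^+ 2) =
    (1 - al ^+ 2) * (1 - (x ^+ 2 + y ^+ 2)) by ring.
by rewrite mulr_gt0 ?subr_gt0// expr_lt1.
Qed.

Lemma is_diff_inv (V : normedModType R) (f df : V -> R) x : f x != 0 ->
  is_diff x f df -> is_diff x (fun y => (f y)^-1) (fun h => - (f x)^-2 * df h).
Proof.
move=> f0 Hf; have df0 : differentiable f x by [].
split; first exact: differentiableV.
by rewrite diffV// diff_val.
Qed.

Lemma is_diff_mobius w : unit_disc w ->
  let dX h := (1 + 2 * al * cre R w + al ^+ 2) * cre R h + 2 * al * cim R w * cim R h in
  let dD h := 2 * al * (1 + al * cre R w) * cre R h + 2 * al ^+ 2 * cim R w * cim R h in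
  is_diff w mobius (fun h => mkC R
    ((dX h * mobD w - mobX w * dD h) / mobD w ^+ 2)
    (((1 - al ^+ 2) * cim R h * mobD w - mobY w * dD h) / mobD w ^+ 2)).
Proof.
move=> Dw dX dD; have D0 := mobD_gt0 w Dw.
have D1 : mobD w != 0 by rewrite gt_eqF.
have x := is_diff_cre R w; have y := is_diff_cim R w.
have k c := is_diff_cst0 R (Cn R 1) c w.
have ax := is_diffD (k 1) (is_diffM (k al) x).
have ay := is_diffM (k al) y.
have HX : is_diff w mobX dX.
  apply: (is_diff_eq (is_diffD (is_diffM (is_diffD x (k al)) ax) (is_diffM (k al) (is_diffM y y)))).
  by apply/funext => h; rewrite !fctE /GRing.scale /= /dX; ring.
have HY : is_diff w mobY (fun h => (1 - al ^+ 2) * cim R h).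
  apply: (is_diff_eq (is_diffM (k (1 - al ^+ 2)) y)).
  by apply/funext => h; rewrite !fctE /GRing.scale /=; ring.
have HD : is_diff w mobD dD.
  apply: (is_diff_eq (is_diffD (is_diffM ax ax) (is_diffM ay ay))).
  by apply/funext => h; rewrite !fctE /GRing.scale /= /dD; ring.
have HV := is_diff_inv _ _ _ _ D1 HD.
apply: (is_diff_eq (is_diff_mkC _ _ _ _ _ _ _ (is_diffM HX HV) (is_diffM HY HV))).
by apply/funext => h; rewrite !fctE /GRing.scale /=; congr mkC; field.
Qed.

Lemma holomorphic_mobius : holomorphic_on mobius (unit_disc (R := R)).
Proof.
move=> w Dw; have H := is_diff_mobius w Dw; split; first by [].
move=> h; rewrite diff_val cre_Jc cim_Jc JcE /mkC.
have D0 := mobD_gt0 w Dw.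
have D1 : mobD w != 0 by rewrite gt_eqF.
congr pair; apply/rowP => i; rewrite !mxE ?cre_Jc ?cim_Jc.
  rewrite -[RHS]mulNr; congr (_ / _).
  by rewrite /mobX /mobY /mobD; ring.
by congr (_ / _); rewrite /mobX /mobY /mobD; ring.
Qed.

Lemma unit_disc0 : unit_disc (0 : Cn R 1).
Proof. by rewrite /unit_disc /= enorm0. Qed.

Lemma mobius0 : mobius 0 = mkC R al 0.
Proof.
rewrite /mobius /mobX /mobY /mobD !cre0 !cim0.
have -> : (1 + al * 0) ^+ 2 + (al * 0) ^+ 2 = 1 by ring.
by congr mkC; field.
Qed.

Lemma is_diff_mobius0 : exists2 dm, is_diff (0 : Cn R 1) mobius dm &
  dm (mkC R 1 0) = mkC R (1 - al ^+ 2) 0.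
Proof.
eexists; first exact: is_diff_mobius unit_disc0.
rewrite /= /mobX /mobY /mobD !cre0 !cim0 cre_mkC cim_mkC.
have -> : (1 + al * 0) ^+ 2 + (al * 0) ^+ 2 = 1 by ring.
by congr mkC; field.
Qed.

End Mobius.

Variable n : nat.
Implicit Types f : Cn R 1 -> Cn R n.

Definition cdisc (r : R) : set (Cn R 1) := [set z | enorm z < r].

(** The disc of radius [r] is rescaled and a Moebius map moves the origin to [s / r]. The composite
    has derivative [(1 - al ^+ 2) * r = (r ^+ 2 - s ^+ 2) / r] times that of [f] along [eta], and
    the half-plane bound applies to it. *)
Lemma harnack_infinitesimal f e c r (eta : Cn R 1) s :
  enorm eta = 1 -> 0 <= s -> s < r -> holomorphic_on f (cdisc r) ->
  (forall z, cdisc r z -> ip R n (f z) e <= c) ->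
  - ip R n ('d f (s *: eta) eta) e * (r ^+ 2 - s ^+ 2)
    <= 2 * r * (c - ip R n (f (s *: eta)) e).
Proof.
move=> eta1 s0 sr hf fc.
have r0 : 0 < r := le_lt_trans s0 sr.
pose al := s / r.
have al0 : 0 <= al by rewrite divr_ge0// ltW.
have al1 : al < 1 by rewrite ltr_pdivrMr// mul1r.
pose A := affC R 0 (r *: eta).
have AE z : enorm (A z) = r * enorm z.
  by rewrite /A /affC add0r enorm_cscale -enorm1E enormZ eta1 mulr1 mulrC gtr0_norm.
have hA : holomorphic_on (f \o A) (unit_disc (R := R)).
  apply: (holomorphic_comp _ _ _ _ _ _ _ _ (holomorphic_affC R _ _ _) hf) => z Dz.
  by rewrite /cdisc /= AE -[ltRHS]mulr1 ltr_pM2l.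
have hM : holomorphic_on ((f \o A) \o mobius al) (unit_disc (R := R)).
  apply: (holomorphic_comp _ _ _ _ _ _ _ _ (holomorphic_mobius al al0 al1) hA) => z.
  exact: mobius_disc.
have bM z : unit_disc z -> ip R n (((f \o A) \o mobius al) z) e <= c.
  move=> /(mobius_disc al al0 al1) Dz; apply: fc.
  by rewrite /cdisc /= AE -[ltRHS]mulr1 ltr_pM2l.
have A1 : A (mkC R al 0) = s *: eta.
  rewrite /A /affC add0r cre_mkC cim_mkC cscaleE scale0r addr0 scalerA.
  by rewrite /al divfK// gt_eqF.
have Ds : cdisc r (s *: eta) by rewrite /cdisc /= enormZ eta1 mulr1 ger0_norm.
have [df _] := hf _ Ds.
have Df : is_diff (A (mkC R al 0)) f ('d f (s *: eta)).
  by rewrite A1; exact: differentiableP.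
have DA := is_diff_comp (is_diff_affC R 0 (r *: eta) (mkC R al 0)) Df.
have [dm Hm dm1] := is_diff_mobius0 al al0 al1.
have DfA : is_diff (mobius al 0) (f \o A)
    ('d f (s *: eta) \o (fun h => Defs.cscale (cre R h) (cim R h) (r *: eta))).
  by rewrite mobius0.
have := half_plane_bound R n _ _ e c hM bM (is_diff_comp Hm DfA).
rewrite /comp mobius0 A1 dm1 cre_mkC cim_mkC cscaleE scale0r addr0 scalerA.
rewrite linearZ /= ipZl => h.
have E : (1 - al ^+ 2) * r * r = r ^+ 2 - s ^+ 2.
  by rewrite /al; field; rewrite gt_eqF.
rewrite -E; nra.
Qed.

(** By the infinitesimal inequality, the defect [u t] times [(r - t) / (r + t)] is nonincreasing
    along the radius. *)
Lemma harnack f e c r (eta : Cn R 1) s :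
  enorm eta = 1 -> 0 <= s -> s < r -> holomorphic_on f (cdisc r) ->
  (forall z, cdisc r z -> ip R n (f z) e <= c) ->
  (c - ip R n (f (s *: eta)) e) * (r - s) <= (c - ip R n (f 0) e) * (r + s).
Proof.
move=> eta1 s0 sr hf fc; have r0 : 0 < r := le_lt_trans s0 sr.
pose u (t : R) := c - ip R n (f (t *: eta)) e.
pose G (t : R) := u t * ((r - t) / (r + t)).
pose dG (t : R) := (- ip R n ('d f (t *: eta) eta) e * (r ^+ 2 - t ^+ 2)
    - 2 * r * u t) / (r + t) ^+ 2.
have dG' (t : R) : 0 <= t -> t < r -> is_derive t 1 G (dG t).
  move=> t0 tr; have dt : cdisc r (t *: eta).
    by rewrite /cdisc /= enormZ eta1 mulr1 ger0_norm.
  have [df _] := hf _ dt.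
  have L := line_derive R n f eta e t df.
  have rt : r + t != 0 by rewrite gt_eqF// ltr_wpDr.
  have I : is_derive t 1 (fun x : R => (r + x)^-1) (- (r + t) ^- 2).
    have K : is_derive t 1 (fun x : R => r + x) 1.
      by rewrite -[X in is_derive _ _ _ X]add0r; exact: (is_deriveD (is_derive_cst r t 1) (is_derive_id t 1)).
    have kd : derivable (fun x : R => r + x) t 1 by [].
    split; first exact: derivableV.
    by rewrite deriveV// derive_val /GRing.scale/= mulr1.
  have U : is_derive t 1 u (- ip R n ('d f (t *: eta) eta) e).
    by rewrite -sub0r; exact: (is_deriveB (is_derive_cst c t 1) L).
  have K : is_derive t 1 (fun x : R => r - x) (- 1).
    by rewrite -sub0r; exact: (is_deriveB (is_derive_cst r t 1) (is_derive_id t 1)).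
  apply: (is_derive_eq (is_deriveM U (is_deriveM K I))); rewrite !fctE /GRing.scale /= /dG; field.
  by rewrite gt_eqF// ltr_wpDr.
have cG : {within `[0, s], continuous G}.
  apply: continuous_in_subspaceT => x; rewrite inE/= in_itv/= => /andP[x0 xs].
  apply: differentiable_continuous; apply/derivable1_diffP.
  by have [] := dG' x x0 (le_lt_trans xs sr).
have [x xs|x /[!in_itv]/= /andP[x0 xs] E] := @MVT_segment R G dG 0 s s0 _ cG.
  by move: xs; rewrite in_itv/= => /andP[/ltW x0 xs]; apply: dG' => //; exact: lt_trans sr.
have dG0 : dG x <= 0.
  have xr := le_lt_trans xs sr.
  rewrite /dG pmulr_lle0 ?invr_gt0 ?exprn_gt0 ?ltr_wpDr// subr_le0.
  exact: harnack_infinitesimal.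
have : G s <= G 0 by rewrite -subr_le0 E mulr_le0_ge0// subr_ge0.
rewrite /G /u scale0r subr0 addr0 divff ?gt_eqF// mulr1 mulrA.
by rewrite ler_pdivrMr// ltr_wpDr.
Qed.

(** A Cauchy estimate obtained from half-planes. The increment is tested against its own direction
    [e], which makes the mean value theorem applicable. On the ball of radius [1 - |z0|] around the
    mean value point, the pairing with [e] has absolute value at most [M * enorm e], whence the
    factor [2 * (M + M)]. *)
Lemma cauchy_lipschitz f M (z0 : Cn R 1) s :
  holomorphic_on f (unit_disc (R := R)) ->
  (forall z, unit_disc z -> enorm (f z) <= M) ->
  unit_disc z0 -> 0 <= s <= 1 ->
  enorm (f z0 - f (s *: z0)) * (1 - enorm z0) <= 4 * M * ((1 - s) * enorm z0).
Proof.
move=> hf fM Dz0 /andP[s0 s1].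
have M0 : 0 <= M by apply: le_trans (fM 0 unit_disc0); exact: enorm_ge0.
have [z00|z00] := eqVneq (enorm z0) 0.
  by rewrite (enorm_eq0 _ _ _ z00) scaler0 subrr !enorm0 mul0r !mulr0.
have z0p : 0 < enorm z0 by rewrite lt_def z00 enorm_ge0.
have rho0 : 0 < 1 - enorm z0 by rewrite subr_gt0.
set e := f z0 - f (s *: z0).
have disc (t : R) : 0 <= t -> t <= 1 -> enorm (t *: z0) <= enorm z0.
  by move=> t0 t1; rewrite enormZ ger0_norm// ler_piMl// enorm_ge0.
have disc' (t : R) : 0 <= t -> t <= 1 -> unit_disc (t *: z0).
  by move=> t0 t1; apply: le_lt_trans Dz0; exact: disc.
pose k (t : R) := ip R n (f (t *: z0)) e.
pose dk (t : R) := ip R n ('d f (t *: z0) z0) e.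
have Dk (t : R) : 0 <= t -> t <= 1 -> is_derive t 1 k (dk t).
  by move=> t0 t1; apply: line_derive; have [] := hf _ (disc' t t0 t1).
have ck : {within `[s, 1], continuous k}.
  apply: continuous_in_subspaceT => x; rewrite inE/= in_itv/= => /andP[sx x1].
  apply: differentiable_continuous; apply/derivable1_diffP.
  by have [] := Dk x (le_trans s0 sx) x1.
have [x xs|x /[!in_itv]/= /andP[sx x1] E] := @MVT_segment R k dk s 1 s1 _ ck.
  move: xs; rewrite in_itv/= => /andP[/ltW sx /ltW x1].
  by apply: Dk => //; exact: le_trans sx.
have ee : enorm e ^+ 2 = dk x * (1 - s).
  by rewrite -E /k -ipBl scale1r enorm_sqr.
have x0 : 0 <= x := le_trans s0 sx.
have fe z : unit_disc z -> ip R n (f z) e <= M * enorm e.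
  move=> Dz; rewrite (le_trans (cauchy_schwarz _ _ _ _))// ler_wpM2r ?enorm_ge0//.
  exact: fM.
have fe' z : unit_disc z -> - ip R n (f z) e <= M * enorm e.
  move=> Dz; rewrite -ipNl (le_trans (cauchy_schwarz _ _ _ _))// enormN.
  by rewrite ler_wpM2r ?enorm_ge0//; exact: fM.
have near z : enorm (z - x *: z0) < 1 - enorm z0 -> unit_disc z.
  move=> zx; rewrite /unit_disc /= -(subrK (x *: z0) z).
  by rewrite (le_lt_trans (ler_enormD _ _ _ _))//; have := disc x x0 x1; lra.
pose w := - ((1 - enorm z0) / enorm z0) *: z0.
have wr : enorm w <= 1 - enorm z0.
  by rewrite /w enormZ normrN ger0_norm ?divfK// divr_ge0 ?(ltW rho0)// ltW.
have := directional_bound R n f (unit_disc (R := R)) (x *: z0) (1 - enorm z0) w e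
  (M * enorm e) hf wr rho0.
have nb z : enorm (z - x *: z0) < 1 - enorm z0 ->
    unit_disc z /\ ip R n (f z) e <= M * enorm e.
  by move=> /near Dz; split => //; exact: fe.
move=> /(_ nb); rewrite /w linearZ /= ipZl mulNr opprK -/(dk x) => h.
have {}h : dk x * (1 - enorm z0) <= 4 * M * enorm e * enorm z0.
  have -> : dk x * (1 - enorm z0) = (1 - enorm z0) / enorm z0 * dk x * enorm z0.
    by field.
  rewrite ler_wpM2r ?enorm_ge0// (le_trans h)//.
  by have := fe' (x *: z0) (disc' x x0 x1); lra.
have [e0|e0] := eqVneq (enorm e) 0.
  by rewrite e0 mul0r !mulr_ge0// ?subr_ge0// enorm_ge0.
have ep : 0 < enorm e by rewrite lt_def e0 enorm_ge0.
rewrite -(ler_pM2l ep) mulrA -expr2 ee.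
have := ler_wpM2r (_ : 0 <= 1 - s) h; rewrite subr_ge0 => /(_ s1); lra.
Qed.

End Harnack.

(** * Discs in convex domains *)
Section Convex.
Variables (R : realType) (n : nat).
Implicit Types (W : set (Cn R n)) (p q x : Cn R n).

(* Take [e = q - x0] with [x0] almost nearest to [q] in [W]: boundedness of [W]
   absorbs the error, so neither closedness nor compactness is needed. *)
Lemma convex_separation W q B D :
  convex_cn W -> (forall x, W x -> enorm x <= B) -> 0 < D ->
  (forall x, W x -> D <= enorm (q - x)) ->
  exists e, forall x, W x -> ip R n x e < ip R n q e.
Proof.
move=> cW bW D0 HD.
have [[w0 Ww0]|W0] := pselect (exists w, W w); last first.
  by exists 0 => x Wx; exfalso; apply: W0; exists x.
pose S := [set enorm (q - x) ^+ 2 | x in W].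
have hS : has_inf S.
  split; first by exists (enorm (q - w0) ^+ 2), w0.
  by exists 0 => _ [x _ <-]; exact: sqr_ge0.
have B4 : 0 < 1 + 4 * B ^+ 2 by have := sqr_ge0 B; lra.
(* Moving from [x0] towards [x] by [t] cannot lower the squared distance by more than the slack
   [t ^+ 2]. With [a] the product of [x - x0] and [q - x0], this gives
   [2 * a < t * (1 + 4 * B ^+ 2) <= D ^+ 2], hence [a] is below the squared distance from [q] to
   [x0]. *)
pose t := Num.min 1 (D ^+ 2 / (1 + 4 * B ^+ 2)).
have t0 : 0 < t by rewrite lt_min ltr01 divr_gt0// exprn_gt0.
have t1 : t <= 1 by rewrite ge_min lexx.
have tD : t * (1 + 4 * B ^+ 2) <= D ^+ 2.
  by rewrite -ler_pdivlMr// /t ge_min lexx orbT.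
have tt0 : 0 < t ^+ 2 by rewrite exprn_gt0.
have [_ [x0 Wx0 <-] near] := inf_adherent tt0 hS.
exists (q - x0) => x Wx.
have Wy : W ((1 - t) *: x0 + t *: x) by apply: cW => //; rewrite ltW.
have far : inf S <= enorm (q - ((1 - t) *: x0 + t *: x)) ^+ 2.
  by apply: ge_inf; [case: hS|eexists; first exact: Wy].
have E : q - ((1 - t) *: x0 + t *: x) = (q - x0) - t *: (x - x0).
  by rewrite scalerBl scale1r scalerBr opprD !opprB !addrA (addrAC q).
have xx0 : ip R n (x - x0) (x - x0) <= 4 * B ^+ 2.
  rewrite -enorm_sqr (_ : 4 * B ^+ 2 = (2 * B) ^+ 2); last by ring.
  rewrite ler_pXn2r ?nnegrE ?enorm_ge0//.
    rewrite (le_trans (ler_enormD _ _ _ _))// enormN.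
    by have := bW x Wx; have := bW x0 Wx0; lra.
  by have := bW x Wx; have := enorm_ge0 _ _ x; lra.
have D2 : D ^+ 2 <= ip R n (q - x0) (q - x0).
  by rewrite -enorm_sqr ler_pXn2r ?nnegrE ?enorm_ge0 ?(ltW D0)//; exact: HD.
rewrite -subr_gt0 -ipBl.
have -> : q - x = (q - x0) - (x - x0) by rewrite opprB addrA subrK.
rewrite ipBl.
move: far near; rewrite E !enorm_sqr !(ipBl _ _ (q - x0)) !(ipBr _ _ _ (q - x0)).
rewrite !ipZl !ipZr (ipC _ _ (q - x0) (x - x0)).
move: xx0 D2; set a := ip R n (x - x0) (q - x0).
set b := ip R n (x - x0) (x - x0); set c := ip R n (q - x0) (q - x0).
move=> b4 Dc h1 h2.
have h3 : t * (2 * a) < t * (t * (1 + b)) by lra.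
rewrite ltr_pM2l// in h3.
have h4 : t * (1 + b) <= t * (1 + 4 * B ^+ 2) by rewrite ler_pM2l//; lra.
have := exprn_gt0 2 D0; lra.
Qed.

(* [q] is the midpoint of [p] and [p + 2 (q - p)], so the latter point keeps a
   positive distance from [W] even if [q] is a boundary point. *)
Lemma midpoint_exterior W p q rho :
  convex_cn W -> ~ W q -> (forall x, enorm (x - p) < rho -> W x) ->
  forall x, W x -> rho <= enorm (p + 2 *: (q - p) - x).
Proof.
move=> cW Wq Wp x Wx; rewrite leNgt; apply/negP => h; apply: Wq.
set d := p + 2 *: (q - p) - x in h.
have Wpd : W (p + d) by apply: Wp; rewrite addrAC subrr add0r.
have h01 : 0 <= (1 / 2 : R) <= 1 by apply/andP; lra.
have := cW _ _ (1 / 2) Wx Wpd h01.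
have -> : p + d = 2 *: q - x.
  by rewrite /d scalerBr !addrA (scaler_nat 2 p) mulr2n (addrC (p + p)) addrK.
have F (u w : Cn R n) : (1 - 1 / 2) *: u + (1 / 2) *: (2 *: w - u) = w.
  rewrite scalerBr scalerA div1r mulVf// scale1r addrC -addrA -scaleNr -scalerDl.
  by rewrite (_ : - _ + _ = 0) ?scale0r ?addr0//; lra.
by rewrite F.
Qed.

Definition has_balls W := forall x, W x -> exists2 rho : R, 0 < rho &
  forall y, enorm (y - x) < rho -> W y.

Lemma exterior_separation W p q B :
  convex_cn W -> has_balls W -> (forall x, W x -> enorm x <= B) ->
  W p -> ~ W q ->
  exists e, forall x, W x -> ip R n x e < ip R n (p + 2 *: (q - p)) e.
Proof.
move=> cW oW bW Wp Wq; have [rho rho0 Hr] := oW p Wp.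
apply: (convex_separation _ _ _ _ cW bW rho0).
exact: midpoint_exterior cW Wq Hr.
Qed.

Lemma dist_bd_separated W x q e : W x -> (forall y, W y -> ip R n y e < ip R n q e) ->
  (dist_bd W x <= ((ip R n q e - ip R n x e) / enorm e)%:E)%E.
Proof.
move=> Wx sep.
have e0 : 0 < enorm e.
  rewrite lt_def enorm_ge0 andbT; apply/eqP => e0.
  by have := sep x Wx; rewrite (enorm_eq0 _ _ _ e0) -(scale0r x) !ipZr !mul0r ltxx.
set u := ip R n q e - ip R n x e.
have u0 : 0 <= u by rewrite subr_ge0 ltW// sep.
(* The orthogonal projection of [x] onto the hyperplane through [q] lies outside [W]. *)
apply: ereal_inf_lbound; exists (x + (u / enorm e ^+ 2) *: e).
  move=> /= /sep; rewrite ipDl ipZl -enorm_sqr divfK ?expf_neq0 ?gt_eqF//.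
  by rewrite /u addrC subrK ltxx.
rewrite addrAC subrr add0r enormZ ger0_norm ?divr_ge0 ?sqr_ge0//.
by congr EFin; field; rewrite gt_eqF.
Qed.

End Convex.

(** * Gradient estimates for discs in a bounded convex domain *)

Section ConvexTarget.
Variables (R : realType) (n : nat) (W : set (Cn R n)) (B : R).
Hypotheses (cW : convex_cn W) (oW : has_balls R n W)
  (bW : forall x, W x -> enorm x <= B).
Variables (g : Cn R 1 -> Cn R n) (r : R) (eta : Cn R 1).
Hypotheses (hg : holomorphic_on g (cdisc R r))
  (gW : forall z, cdisc R r z -> W (g z)) (eta1 : enorm eta = 1).

Lemma cdisc_line s : 0 <= s -> s < r -> cdisc R r (s *: eta).
Proof. by move=> s0 sr; rewrite /cdisc /= enormZ eta1 mulr1 ger0_norm. Qed.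

(* In the direction [a + i b] the derivative of [g] is exactly [q - g (s eta)], so
   the half-plane bound compares the separating functional with itself. *)
Lemma convex_gradient_exterior s a b : 0 <= s -> s < r ->
  ~ W (g (s *: eta) + Defs.cscale a b ('d g (s *: eta) eta)) ->
  r - s <= 4 * Num.sqrt (a ^+ 2 + b ^+ 2).
Proof.
move=> s0 sr; set z := s *: eta; set w := 'd g z eta; set q := _ + _ => Wq.
have Dz : cdisc R r z by exact: cdisc_line.
have Wz := gW z Dz.
rewrite leNgt; apply/negP => lt.
have [ab|ab] := eqVneq (Num.sqrt (a ^+ 2 + b ^+ 2)) 0.
  apply: Wq; rewrite /q (_ : Defs.cscale a b w = 0) ?addr0//.
  by apply: enorm_eq0; rewrite enorm_cscale ab mul0r.
have ab0 : 0 < Num.sqrt (a ^+ 2 + b ^+ 2) by rewrite lt_def ab sqrtr_ge0.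
have [e sep] := exterior_separation R n W (g z) q B cW oW bW Wz Wq.
(* The vector [om] below has length [r - s], and the derivative sends it to [- k] times [q - g z].
   With [X > 0] the product of [q - g z] and [e], the directional bound reads [k * X <= 4 * X]: one
   factor 2 is the half-plane constant, the other the doubling of [q - g z]. *)
pose k := (r - s) / Num.sqrt (a ^+ 2 + b ^+ 2).
have k4 : 4 < k by rewrite /k ltr_pdivlMr.
have rs0 : 0 < r - s by rewrite subr_gt0.
pose om := - k *: Defs.cscale a b eta.
have omr : enorm om <= r - s.
  rewrite /om enormZ normrN gtr0_norm; last by lra.
  by rewrite enorm_cscale eta1 mulr1 /k divfK.
have H y : enorm (y - z) < r - s ->
    cdisc R r y /\ ip R n (g y) e <= ip R n (g z + 2 *: (q - g z)) e.
  move=> yz; have Dy : cdisc R r y.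
    rewrite /cdisc /= -(subrK z y) (le_lt_trans (ler_enormD _ _ _ _))//.
    by rewrite /z enormZ eta1 mulr1 ger0_norm// -/z; lra.
  by split => //; apply/ltW/sep/gW.
have := directional_bound R n g _ z (r - s) om e _ hg omr rs0 H.
have [dg CR] := hg z Dz.
have Ed : 'd g z om = - k *: (q - g z) :> Cn R n.
  rewrite /om linearZ /= cscaleE linearD !linearZ /= CR -cscaleE -/w.
  by rewrite /q (addrC (g z)) addrK.
have -> : ip R n ('d g z om) e = - (k * ip R n (q - g z) e).
  by rewrite Ed ipZl mulNr.
rewrite opprK (ipDl _ _ (g z)) ipZl.
have pos : 0 < ip R n (q - g z) e.
  by have := sep _ Wz; rewrite (ipDl _ _ (g z)) ipZl; lra.
have k40 : 0 < k - 4 by rewrite subr_gt0.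
by have := mulr_gt0 k40 pos; lra.
Qed.

Lemma convex_gradient_dist_dir s : 0 <= s -> s < r ->
  ((enorm ('d g (s *: eta) eta) * (r - s) / 4)%:E <=
   dist_dir W (g (s *: eta)) ('d g (s *: eta) eta))%E.
Proof.
move=> s0 sr; apply/ereal_infP => _ [q [[a _ [b _ <-]] Wq] <-].
rewrite lee_fin addrAC subrr add0r enorm_cscale.
have := convex_gradient_exterior s a b s0 sr Wq.
have := enorm_ge0 _ _ ('d g (s *: eta) eta); nra.
Qed.

Variables (q : Cn R n) (A : R).
Hypotheses (r1 : r <= 1) (Wq : ~ W q) (qA : enorm (q - g 0) <= A).

(** For a functional separating [W] from the reflection of [g 0] through [q], the defect at [g 0] is
    at most [2 * A * enorm e]. Harnack multiplies it by at most [2 / (r - s)], and the defect over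
    [enorm e] bounds the distance to the complement. *)
Lemma dist_bd_growth s : 0 <= s -> s < r ->
  (dist_bd W (g (s *: eta)) <= (4 * A / (r - s))%:E)%E.
Proof.
move=> s0 sr; have r0 := le_lt_trans s0 sr.
have D0 : cdisc R r 0 by rewrite /cdisc /= enorm0.
have rs0 : 0 < r - s by rewrite subr_gt0.
have [e sep] := exterior_separation R n W (g 0) q B cW oW bW (gW 0 D0) Wq.
have Ds := cdisc_line s s0 sr.
apply: le_trans (dist_bd_separated _ _ _ _ _ _ (gW _ Ds) sep) _.
have e0 : 0 < enorm e.
  rewrite lt_def enorm_ge0 andbT; apply/eqP => e0.
  have := sep _ (gW 0 D0).
  by rewrite (enorm_eq0 _ _ _ e0) -(scale0r q) !ipZr !mul0r ltxx.
rewrite lee_fin ler_pdivrMr// mulrAC ler_pdivlMr//.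
have hb z : cdisc R r z -> ip R n (g z) e <= ip R n (g 0 + 2 *: (q - g 0)) e.
  by move=> Dz; apply/ltW/sep/gW.
apply: le_trans (harnack R n g e _ r eta s eta1 s0 sr hg hb) _.
rewrite (ipDl _ _ (g 0)) ipZl [_ + 2 * _ - _]addrAC subrr add0r.
have X0 : 0 < ip R n (q - g 0) e.
  by have := sep _ (gW 0 D0); rewrite (ipDl _ _ (g 0)) ipZl; lra.
have XA : ip R n (q - g 0) e <= A * enorm e.
  by rewrite (le_trans (cauchy_schwarz _ _ _ _))// ler_wpM2r// ltW.
have rs2 : r + s <= 2 by move: r1 sr; lra.
apply: (@le_trans _ _ (2 * ip R n (q - g 0) e * 2)); last by lra.
by rewrite ler_wpM2l//; lra.
Qed.

(** The directional distance is bounded below by the gradient and above by the type condition, whose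
    right side is controlled by [dist_bd_growth]. A vanishing derivative is treated apart because it
    has no direction. *)
Lemma convex_gradient_type s a C : 0 <= s -> s < r -> 0 <= a -> 0 <= C -> 0 <= A ->
  (forall p v, W p -> v != 0 ->
    (dist_dir W p v <= C%:E * poweR (dist_bd W p) a)%E) ->
  enorm ('d g (s *: eta) eta) * (r - s) <= 4 * C * (4 * A / (r - s)) `^ a.
Proof.
move=> s0 sr a0 C0 A0 HC; set w := 'd g (s *: eta) eta.
have rs0 : 0 < r - s by rewrite subr_gt0.
have Ws := gW _ (cdisc_line s s0 sr).
have [w0|w0] := eqVneq w 0.
  by rewrite w0 enorm0 mul0r !mulr_ge0// powR_ge0.
have := le_trans (convex_gradient_dist_dir s s0 sr) (HC _ _ Ws w0).
have d0 : (0 <= dist_bd W (g (s *: eta)))%E.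
  by apply/ereal_infP => _ [y _ <-]; rewrite lee_fin enorm_ge0.
have X0 : 0 <= 4 * A / (r - s) by rewrite divr_ge0 ?mulr_ge0// ltW.
have P : (poweR (dist_bd W (g (s *: eta))) a <= ((4 * A / (r - s)) `^ a)%:E)%E.
  rewrite -poweR_EFin; apply: gt0_ler_poweR => //.
  - by rewrite in_itv /= d0 leey.
  - by rewrite in_itv /= lee_fin X0 leey.
  - exact: dist_bd_growth.
have C0' : (0 <= C%:E)%E by rewrite lee_fin.
move=> h; have := le_trans h (lee_wpmul2l C0' P).
by rewrite -EFinM lee_fin -/w; lra.
Qed.

End ConvexTarget.

(** * Integration of the gradient estimate along a radius *)

Section Displacement.
Variables (R : realType) (n : nat).

(** The gradient is at most [K * (r - s) ^ (- a - 1)], with primitive [K / a * (r - s) ^ (- a)].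
    Pairing with the total displacement [e] replaces the vector integral by monotonicity of the
    scalar function [G]. *)
Lemma displacement_bound (g : Cn R 1 -> Cn R n) (eta : Cn R 1) (r a K t : R) :
  (forall s, 0 <= s -> s < r -> differentiable g (s *: eta)) ->
  0 < a -> 0 <= K -> 0 <= t -> t < r ->
  (forall s, 0 <= s -> s < r ->
    enorm ('d g (s *: eta) eta) * (r - s) <= K * (r - s)^-1 `^ a) ->
  enorm (g (t *: eta) - g 0) <= K / a * (r - t)^-1 `^ a.
Proof.
move=> dg a0 K0 t0 tr HK; set e := g (t *: eta) - g 0.
pose G s := ip R n (g (s *: eta)) e - enorm e * (K / a) * (r - s) `^ (- a).
pose dG s := ip R n ('d g (s *: eta) eta) e - enorm e * K * (r - s) `^ (- a - 1).
have DG (s : R) : 0 <= s -> s < r -> is_derive s 1 G (dG s).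
  move=> s0 sr; have L := line_derive R n g eta e s (dg s s0 sr).
  have rs0 : 0 < r - s by rewrite subr_gt0.
  have D1 : is_derive s 1 (fun x : R => r - x) (- 1).
    by rewrite -sub0r; exact: (is_deriveB (is_derive_cst r s 1) (is_derive_id s 1)).
  have D2 := @is_derive1_comp R (fun y => y `^ (- a)) (fun x => r - x) s _ _
    (is_derive1_powR (- a) rs0) D1.
  have D3 := is_deriveM (is_derive_cst (enorm e * (K / a)) s 1) D2.
  apply: (is_derive_eq (is_deriveB L D3)).
  rewrite /dG /= scaler0 addr0 /GRing.scale /=; field.
  by rewrite gt_eqF.
have cG : {within `[0, t], continuous G}.
  apply: continuous_in_subspaceT => x; rewrite inE/= in_itv/= => /andP[x0 xt].
  apply: differentiable_continuous; apply/derivable1_diffP.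
  by have [] := DG x x0 (le_lt_trans xt tr).
have [x xs|x /[!in_itv]/= /andP[x0 xt] E] := @MVT_segment R G dG 0 t t0 _ cG.
  by move: xs; rewrite in_itv/= => /andP[/ltW x0 xt]; apply: DG => //; exact: lt_trans tr.
have xr := le_lt_trans xt tr; have rx0 : 0 < r - x by rewrite subr_gt0.
have rt0 : 0 < r - t by rewrite subr_gt0.
have inv (y : R) : 0 < y -> y^-1 `^ a = y `^ (- a).
  by move=> y0; rewrite -powR_inv1 ?ltW// -powRrM mulN1r.
have dG0 : dG x <= 0.
  rewrite /dG subr_le0 (le_trans (cauchy_schwarz _ _ _ _))// mulrC -mulrA.
  rewrite ler_wpM2l ?enorm_ge0// powRB ?(gt_eqF rx0) ?implybT//.
  by rewrite powRr1 ?(ltW rx0)// mulrA ler_pdivlMr// -inv//; exact: HK.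
have GG : G t <= G 0 by rewrite -subr_le0 E mulr_le0_ge0// subr_ge0.
rewrite inv//.
have e2 : enorm e ^+ 2 <= enorm e * (K / a * (r - t) `^ (- a)).
  have -> : enorm e ^+ 2 = ip R n (g (t *: eta)) e - ip R n (g 0) e.
    by rewrite -ipBl enorm_sqr.
  move: GG; rewrite /G scale0r subr0.
  have : 0 <= enorm e * (K / a) * r `^ (- a).
    by rewrite !mulr_ge0 ?enorm_ge0 ?powR_ge0// invr_ge0 ltW.
  lra.
have [e0|e0] := eqVneq (enorm e) 0.
  by rewrite e0 !mulr_ge0 ?powR_ge0// invr_ge0 ltW.
have ep : 0 < enorm e by rewrite lt_def e0 enorm_ge0.
by rewrite -(ler_pM2l ep) -expr2.
Qed.

End Displacement.


(** * Localization *)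
Section Localization.
Variable R : realType.

Lemma nbhs_enorm_ball n (x : Cn R n) (A : set (Cn R n)) : nbhs x A ->
  exists2 rho : R, 0 < rho & forall y, enorm (y - x) < rho -> A y.
Proof.
move=> /nbhs_ballP[rho /= rho0 H]; exists rho => // y yx; apply: H.
rewrite -ball_normE /= -normrN opprB.
exact: le_lt_trans (normr_le_enorm _ _ _) yx.
Qed.

Lemma open_has_balls n (U : set (Cn R n)) : open U -> has_balls R n U.
Proof. by move=> oU x Ux; apply: nbhs_enorm_ball; exact: open_nbhs_nbhs. Qed.

(** Near [F x] the image is the preimage of the open set [V] intersected with [U] under the inverse
    map, which is continuous there. *)
Lemma biholomorphic_image_has_balls n (F : Cn R n -> Cn R n) (V U : set (Cn R n)) :
  biholomorphic_onto_image F V -> open U -> has_balls R n (F @` (V `&` U)).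
Proof.
move=> [oV [oFV [hF [G [hG [GF FG]]]]]] oU _ [x [Vx Ux] <-].
have FVx : (F @` V) (F x) by exists x.
apply: nbhs_enorm_ball.
have [dG _] := hG _ FVx.
have cG := differentiable_continuous dG.
have nV : nbhs (F x) (F @` V) by exact: open_nbhs_nbhs.
have nU : nbhs (F x) (G @^-1` (V `&` U)).
  by apply: cG; rewrite GF//; apply: open_nbhs_nbhs; split => //; exact: openI.
apply: filterS (filterI nV nU) => y [FVy /= VUy].
by exists (G y) => //; exact: FG.
Qed.

Lemma holomorphic_subset m n (f : Cn R m -> Cn R n) (A B : set (Cn R m)) :
  A `<=` B -> holomorphic_on f B -> holomorphic_on f A.
Proof. by move=> AB hf z /AB; exact: hf. Qed.

Lemma kobayashi_subset n (A B : set (Cn R n)) p v : A `<=` B ->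
  (kobayashi B p v <= kobayashi A p v)%E.
Proof.
move=> AB; apply: le_ereal_inf => _ [z [f [hf [fA [f0 df]]]] <-].
by exists z => //; exists f; split => //; split => // w /fA /AB.
Qed.

(** The rescaled disc [z |-> f (rho z)] stays in [V] and realizes [v] at [zeta / rho], so localizing
    costs the factor [rho^-1]. *)
Lemma kobayashi_localization n (Omega V : set (Cn R n)) p v (rho E : R) :
  0 < rho -> rho <= 1 -> rho^-1 <= E ->
  (forall f : Cn R 1 -> Cn R n, holomorphic_on f (unit_disc (R := R)) ->
    (forall z, unit_disc z -> Omega (f z)) -> f 0 = p ->
    forall z, enorm z < rho -> V (f z)) ->
  (kobayashi (Omega `&` V) p v <= E%:E * kobayashi Omega p v)%E.
Proof.
move=> rho0 rho1 rE H.
have E0 : 0 < E by apply: lt_le_trans rE; rewrite invr_gt0.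
rewrite -lee_pdivrMl//; apply/ereal_infP => _ [z [f [hf [fO [f0 df]]]] <-].
rewrite lee_pdivrMl//.
pose w : Cn R 1 := mkC R rho 0.
have wE : affC R 0 w = ( *:%R rho : Cn R 1 -> Cn R 1).
  apply/funext => h; rewrite /affC add0r -[h in RHS]mkCK [in RHS]mkCE cscaleE.
  rewrite /w (mkCE R rho 0) scale0r addr0 scalerDr !scalerA; congr (_ + _).
    by rewrite mulrC.
  have -> : Jc (rho *: mkC R 1 0) = rho *: mkC R 0 1.
    by rewrite JcE /mkC; congr pair; apply/rowP => i; rewrite !mxE ?mulr0 ?oppr0.
  by rewrite scalerA mulrC.
have sub h : unit_disc h -> enorm (rho *: h) < rho.
  rewrite /unit_disc /= enormZ gtr0_norm// => h1.
  by rewrite -[ltRHS]mulr1 ltr_pM2l.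
have subD h : unit_disc h -> unit_disc (rho *: h).
  by move=> /sub h1; exact: lt_le_trans h1 rho1.
apply: ge_ereal_inf; exists ((enorm (rho^-1 *: z))%:E); last first.
  rewrite -EFinM lee_fin enormZ gtr0_norm ?invr_gt0// ler_wpM2r// enorm_ge0//.
exists (rho^-1 *: z) => //; exists (f \o ( *:%R rho)).
have hs : holomorphic_on ( *:%R rho : Cn R 1 -> Cn R 1) (unit_disc (R := R)).
  by rewrite -wE; exact: holomorphic_affC.
split; first exact: (holomorphic_comp _ _ _ _ _ _ _ _ hs hf).
split; first by move=> h Dh; split; [apply/fO/subD|apply: (H f hf fO f0); exact: sub].
split; first by rewrite /= scaler0.
have Hs : is_diff (0 : Cn R 1) ( *:%R rho : Cn R 1 -> Cn R 1) ( *:%R rho).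
  exact: is_diff_scaler.
have [dfz _] := hf 0 (unit_disc0 R).
have Df : is_diff (rho *: (0 : Cn R 1)) f ('d f 0).
  by rewrite scaler0; exact: differentiableP.
rewrite (@diff_val _ _ _ _ _ _ _ (is_diff_comp Hs Df)) /= scalerA divff ?gt_eqF//.
by rewrite scale1r.
Qed.

(** * Confinement of discs centred near a boundary point *)

Section Confinement.
Variables (n L : nat) (Omega V : set (Cn R n)) (Phi : Cn R n -> Cn R n).
Variables (xi p q : Cn R n) (tau C M delta : R) (f : Cn R 1 -> Cn R n).
Hypotheses (tau0 : 0 < tau) (C0 : 0 < C) (M0 : 0 < M) (delta0 : 0 < delta).
Hypotheses (oO : open Omega) (bO : forall z, Omega z -> enorm z <= M).
Hypotheses (bihol : biholomorphic_onto_image Phi V).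
Let W := Phi @` (V `&` Omega).
Hypotheses (cW : convex_cn W) (tauV : eball xi tau `<=` V).
Hypothesis lip : forall x y, V x -> V y ->
  C^-1 * enorm (x - y) <= enorm (Phi x - Phi y) /\
  enorm (Phi x - Phi y) <= C * enorm (x - y).
Hypothesis typeW : forall x v, W x -> v != 0 ->
  (dist_dir W x v <= C%:E * poweR (dist_bd W x) L%:R^-1)%E.
Hypotheses (Oq : ~ Omega q) (qp : enorm (q - p) <= 2 * delta).
Hypotheses (pxi : enorm (p - xi) < tau / 4) (dtau : delta <= tau / 4).
Hypotheses (hf : holomorphic_on f (unit_disc (R := R)))
  (fO : forall z, unit_disc z -> Omega (f z)) (f0 : f 0 = p).

(** The constants solve two equations: [4 * C * L * theta = tau / (4 * C)], the displacement allowed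
    in the chart, and [8 * C * delta / (K * delta) = theta ^ L], which makes the L-th root in the
    gradient bound equal to [theta] at distance [K * delta] from the circle. *)
Let theta := tau / (16 * C ^+ 2 * L%:R).
Let K := 8 * C / theta ^+ L.

(** In the chart the displacement from the centre is at most [tau / (4 * C)]; the lower Lipschitz
    bound of the chart turns this into [tau / 4]. *)
Lemma chart_displacement (r t : R) (eta : Cn R 1) :
  (0 < L)%N -> r <= 1 -> (forall z, enorm z < r -> enorm (f z - xi) < tau) ->
  enorm eta = 1 -> 0 <= t -> r - t = K * delta ->
  enorm (f (t *: eta) - p) <= tau / 4.
Proof.
move=> L0 r1 fr eta1 t0 rt.
have L0' : 0 < L%:R :> R by rewrite ltr0n.
have th0 : 0 < theta by rewrite divr_gt0// !mulr_gt0// exprn_gt0.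
have K0 : 0 < K by rewrite divr_gt0 ?mulr_gt0// exprn_gt0.
have tr : t < r by rewrite -subr_gt0 rt mulr_gt0.
have r0 : 0 < r := le_lt_trans t0 tr.
have Dr z : cdisc R r z -> unit_disc z by move=> zr; exact: lt_le_trans zr r1.
have fV z : cdisc R r z -> V (f z) by move=> zr; apply: tauV; exact: fr.
have D0 : cdisc R r 0 by rewrite /cdisc /= enorm0.
have Vp : V p by rewrite -f0; exact: fV.
have Vxi : V xi by apply: tauV; rewrite /eball /= subrr enorm0.
(* The exterior point is within [2 * delta + tau / 4 < tau] of [xi], so the chart maps it to a point
   outside [W]. *)
have Vq : V q.
  apply: tauV; rewrite /eball /=.
  by apply: le_lt_trans (ler_enorm_dist R n q p xi) _; move: qp pxi dtau tau0; lra.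
have [_ [_ [hPhi [G [_ [GF _]]]]]] := bihol.
have Wq : ~ W (Phi q).
  by move=> [y [Vy Oy] E]; apply: Oq; rewrite -(GF q Vq) -E GF.
pose g := Phi \o f.
have hg : holomorphic_on g (cdisc R r).
  apply: (holomorphic_comp _ _ _ _ _ _ _ _ (holomorphic_subset _ _ _ _ _ Dr hf) hPhi).
  exact: fV.
have gW z : cdisc R r z -> W (g z).
  by move=> Dz; exists (f z) => //; split; [exact: fV|exact/fO/Dr].
have oW : has_balls R n W by exact: biholomorphic_image_has_balls.
have bW x : W x -> enorm x <= enorm (Phi xi) + C * (M + enorm xi).
  move=> [y [Vy Oy] <-]; rewrite -[Phi y](subrK (Phi xi)) addrC.
  rewrite (le_trans (ler_enormD _ _ _ _))// lerD2l.
  rewrite (le_trans (lip _ _ Vy Vxi).2)// ler_wpM2l ?(ltW C0)//.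
  by rewrite (le_trans (ler_enormD _ _ _ _))// enormN lerD2r bO.
have qA : enorm (Phi q - g 0) <= C * (2 * delta).
  rewrite /g /= f0 (le_trans (lip _ _ Vq Vp).2)// ler_wpM2l// ltW//.
have A0 : 0 <= C * (2 * delta) by rewrite !mulr_ge0// ltW.
have A4 : 0 <= 4 * (C * (2 * delta)) by rewrite mulr_ge0.
have a0 : 0 < L%:R^-1 :> R by rewrite invr_gt0.
have grad (s : R) : 0 <= s -> s < r -> enorm ('d g (s *: eta) eta) * (r - s) <=
    4 * C * (4 * (C * (2 * delta))) `^ L%:R^-1 * (r - s)^-1 `^ L%:R^-1.
  move=> s0 sr; have rs0 : 0 <= (r - s)^-1 by rewrite invr_ge0 subr_ge0 ltW.
  rewrite -mulrA -powRM//.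
  exact: (convex_gradient_type R n W _ cW oW bW g r eta hg gW eta1 (Phi q)
    (C * (2 * delta)) r1 Wq qA s L%:R^-1 C s0 sr (ltW a0) (ltW C0) A0 typeW).
have dg : forall s : R, 0 <= s -> s < r -> differentiable g (s *: eta).
  move=> s s0 sr; by have [] := hg _ (cdisc_line R r eta eta1 s s0 sr).
have KK : 0 <= 4 * C * (4 * (C * (2 * delta))) `^ L%:R^-1.
  by rewrite !mulr_ge0 ?powR_ge0// ltW.
have := displacement_bound R n g eta r _ _ t dg a0 KK t0 tr grad.
have e1 : (4 * (C * (2 * delta))) `^ L%:R^-1 * (r - t)^-1 `^ L%:R^-1 = theta.
  have rt0 : 0 <= (r - t)^-1 by rewrite invr_ge0 subr_ge0 ltW.
  rewrite -powRM//.
  have -> : 4 * (C * (2 * delta)) * (r - t)^-1 = theta ^+ L.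
    rewrite rt /K; field.
    by rewrite ?expf_neq0 ?gt_eqF.
  rewrite -powR_mulrn ?ltW// -powRrM divff ?gt_eqF// powRr1// ltW//.
have -> : 4 * C * (4 * (C * (2 * delta))) `^ L%:R^-1 / L%:R^-1 * (r - t)^-1 `^ L%:R^-1
    = 4 * C * L%:R * theta.
  by rewrite invrK -e1; ring.
have -> : 4 * C * L%:R * theta = C^-1 * (tau / 4).
  by rewrite /theta; field; rewrite !gt_eqF.
rewrite /g /= f0 => h.
have Dt : cdisc R r (t *: eta) by exact: cdisc_line.
have [lo _] := lip _ _ (fV _ Dt) Vp.
by have := le_trans lo h; rewrite ler_pM2l ?invr_gt0.
Qed.

(* [r] is the radius of the largest disc mapped into the ball; [f] is compared at
   an almost extremal point [z0] and at the point [t eta] of the same ray, which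
   is [K * delta] inside the disc. *)
Lemma confinement z : (0 < L)%N ->
  enorm z < 1 - 32 * M * K / tau * delta -> enorm (f z - xi) < tau.
Proof.
move=> L0 zlt; rewrite ltNge; apply/negP => zbad.
have L0' : 0 < L%:R :> R by rewrite ltr0n.
have th0 : 0 < theta by rewrite divr_gt0// !mulr_gt0// exprn_gt0.
have K0 : 0 < K by rewrite divr_gt0 ?mulr_gt0// exprn_gt0.
(* Chosen so that [4 * M * (2 * K * delta) = tau / 4 * (C' * delta)], as the Cauchy estimate near
   [z0] requires. *)
set C' := 32 * M * K / tau in zlt.
have C'0 : 0 < C' by rewrite /C' divr_gt0// mulr_gt0// mulr_gt0.
have Kd : 0 < K * delta by rewrite mulr_gt0.
have Cd : 0 < C' * delta by rewrite mulr_gt0.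
pose S := [set enorm y | y in [set y : Cn R 1 | enorm y < 1 /\ tau <= enorm (f y - xi)]].
have Sz : S (enorm z) by exists z => //; split => //; move: zlt Cd; lra.
have lS : has_lbound S by exists 0 => _ [y _ <-]; exact: enorm_ge0.
have hS : has_inf S by split => //; exists (enorm z).
set r := inf S.
have rz : r <= enorm z by exact: ge_inf.
have r0 : 0 <= r by apply: lb_le_inf; [exists (enorm z)|move=> _ [y _ <-]; exact: enorm_ge0].
have r1 : r <= 1 by move: zlt Cd rz; lra.
have fr y : enorm y < r -> enorm (f y - xi) < tau.
  move=> yr; rewrite ltNge; apply/negP => yb.
  have : r <= enorm y by apply: ge_inf => //; exists y => //; split => //; exact: lt_le_trans yr r1.
  by rewrite leNgt yr.
(* The first entry keeps [z0] within [2 * K * delta] of [t * eta]; the second keeps it at distance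
   more than [C' * delta] from the unit circle. *)
have mn : 0 < Num.min (K * delta) (1 - C' * delta - r).
  by rewrite lt_min Kd /= subr_gt0 (le_lt_trans rz).
have [_ [z0 [z01 z0b] <-]] := inf_adherent mn hS.
rewrite -/r -ltrBlDl lt_min => /andP[z0K z0C].
have rz0 : r <= enorm z0 by apply: ge_inf => //; exists z0.
have z0p : 0 < enorm z0.
  rewrite lt_def enorm_ge0 andbT; apply/eqP => e0; move: z0b.
  by rewrite (enorm_eq0 _ _ _ e0) f0; move: pxi tau0; lra.
pose eta := (enorm z0)^-1 *: z0.
have eta1 : enorm eta = 1.
  by rewrite /eta enormZ ger0_norm ?invr_ge0 ?enorm_ge0// mulVf// gt_eqF.
(* If [r <= K * delta], the comparison point is the centre, where [f] equals [p]. *)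
pose t := Num.max 0 (r - K * delta).
have t0 : 0 <= t by rewrite /t le_max lexx.
have tr : t <= enorm z0 by rewrite /t ge_max enorm_ge0 /=; move: Kd rz0; lra.
have tK : r - K * delta <= t by rewrite /t le_max lexx orbT.
have near_p : enorm (f (t *: eta) - p) <= tau / 4.
  have [h|h] := leP (r - K * delta) 0.
    have -> : t = 0 by rewrite /t; apply/max_idPl.
    by rewrite scale0r f0 subrr enorm0 divr_ge0// ltW.
  apply: (chart_displacement r) => //.
  have -> : t = r - K * delta by rewrite /t; apply/max_idPr/ltW.
  by rewrite opprB addrC subrK.
have near_z0 : enorm (f z0 - f (t *: eta)) <= tau / 4.
  have sE : t *: eta = (t / enorm z0) *: z0 by rewrite /eta scalerA.
  have s01 : 0 <= t / enorm z0 <= 1.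
    by rewrite divr_ge0 ?enorm_ge0//= ler_pdivrMr// mul1r.
  have fM y : unit_disc y -> enorm (f y) <= M by move=> Dy; apply/bO/fO.
  have := cauchy_lipschitz R n f M z0 _ hf fM z01 s01.
  rewrite -sE (_ : (1 - t / enorm z0) * enorm z0 = enorm z0 - t); last first.
    by field; rewrite gt_eqF.
  move=> h.
  have h2 : 4 * M * (enorm z0 - t) <= 4 * M * (2 * (K * delta)).
    by rewrite ler_wpM2l ?mulr_ge0 ?(ltW M0)//; move: tK z0K; lra.
  have h3 : enorm (f z0 - f (t *: eta)) * (C' * delta) <=
      enorm (f z0 - f (t *: eta)) * (1 - enorm z0).
    by rewrite ler_wpM2l ?enorm_ge0//; move: z0C; lra.
  have h4 : 4 * M * (2 * (K * delta)) = tau / 4 * (C' * delta).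
    by rewrite /C'; field; rewrite gt_eqF.
  rewrite -(ler_pM2r Cd) -h4; exact: le_trans h3 (le_trans h h2).
(* Three distances of at most [tau / 4] contradict [tau <= enorm (f z0 - xi)]. *)
have := ler_enorm_dist R n (f z0) (f (t *: eta)) xi.
have := ler_enorm_dist R n (f (t *: eta)) p xi.
by move: z0b near_p near_z0 pxi tau0; lra.
Qed.

(** The Cauchy estimate against the centre alone: a disc of fixed radius stays in the ball. This
    serves the case [L = 0]. *)
Lemma confinement_constant z : enorm z < (1 + 16 * M / tau)^-1 ->
  enorm (f z - xi) < tau.
Proof.
have k0 : 0 <= 16 * M / tau by rewrite divr_ge0 ?mulr_ge0// ltW.
have k1 : 0 < 1 + 16 * M / tau by lra.
move=> zr; have z1 : enorm z < 1.
  by apply: (lt_le_trans zr); rewrite invf_le1//; lra.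
have s01 : 0 <= (0 : R) <= 1 by rewrite lexx ler01.
have fM y : unit_disc y -> enorm (f y) <= M by move=> Dy; apply/bO/fO.
have := cauchy_lipschitz R n f M z 0 hf fM z1 s01.
rewrite scale0r f0 subr0 mul1r => h.
have h1 : enorm z * (1 + 16 * M / tau) < 1 by rewrite -ltr_pdivlMr// div1r.
have h2 : 4 * M * enorm z < tau / 4 * (1 - enorm z).
  have -> : 4 * M * enorm z = tau / 4 * (enorm z * (16 * M / tau)).
    by field; rewrite gt_eqF.
  by rewrite ltr_pM2l ?divr_gt0//; move: h1; lra.
have h3 : enorm (f z - p) < tau / 4.
  rewrite -(ltr_pM2r (_ : 0 < 1 - enorm z)) ?subr_gt0//.
  exact: le_lt_trans h h2.
have := ler_enorm_dist R n (f z) p xi.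
by move: h3 pxi tau0; lra.
Qed.

End Confinement.

(** The point [xi] outside [Omega] makes the distance finite, so [fine] returns its true value; the
    factor 2 provides an exterior point without requiring that the infimum be attained. *)
Lemma dist_bd_near_exterior n (Omega : set (Cn R n)) p xi :
  open Omega -> Omega p -> ~ Omega xi ->
  let delta := fine (dist_bd Omega p) in
  [/\ 0 < delta, delta <= enorm (p - xi) &
    exists2 q, ~ Omega q & enorm (q - p) <= 2 * delta].
Proof.
move=> oO Op Oxi delta.
have up : (dist_bd Omega p <= (enorm (p - xi))%:E)%E.
  by apply: ereal_inf_lbound; exists xi => //; rewrite enormB.
have [rho rho0 Hr] := open_has_balls n Omega oO p Op.
have lo : (rho%:E <= dist_bd Omega p)%E.
  apply/ereal_infP => _ [y Oy <-]; rewrite lee_fin leNgt; apply/negP => /Hr.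
  exact: Oy.
have fin : dist_bd Omega p \is a fin_num.
  by rewrite fin_real// (lt_le_trans (ltNyr _) lo) (le_lt_trans up (ltry _)).
have dE : dist_bd Omega p = delta%:E by rewrite fineK.
have d0 : 0 < delta by rewrite (lt_le_trans rho0)// -lee_fin -dE.
split => //; first by rewrite -lee_fin -dE.
have : (dist_bd Omega p < (2 * delta)%:E)%E by rewrite dE lte_fin; lra.
by move=> /ereal_inf_lt[_ [y Oy <-]]; rewrite lte_fin => /ltW; exists y.
Qed.

Lemma le_powR_invn (x : R) (L : nat) : (0 < L)%N -> 0 <= x -> x <= 1 ->
  x <= x `^ L%:R^-1.
Proof.
move=> L0 x0 x1.
have L0' : (L%:R : R) != 0 by rewrite pnatr_eq0 -lt0n.
have y1 : x `^ L%:R^-1 <= 1.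
  have E : (1 : R) `^ L%:R^-1 = 1 by rewrite powR1.
  by rewrite -[leRHS]E ge0_ler_powR ?nnegrE// invr_ge0.
have {1}-> : x = (x `^ L%:R^-1) ^+ L.
  by rewrite -powR_mulrn ?powR_ge0// -powRrM mulVf// powRr1.
by rewrite -[leRHS]expr1 ler_wiXn2l ?powR_ge0.
Qed.

End Localization.

Theorem theorem16p1 (R : realType) (d : nat) (Omega : set (Cn R d)) (L : nat)
    (V : Cn R d -> set (Cn R d)) (Phi : Cn R d -> Cn R d -> Cn R d) :
  open Omega -> ebounded Omega ->
  locally_convexifiable Omega -> finite_local_line_type Omega L ->
  good_atlas Omega L V Phi ->
  exists c eps : R, 0 < c /\ 0 < eps /\
    forall xi p v, boundary Omega xi -> eball xi eps p -> Omega p ->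
      (kobayashi Omega p v <= kobayashi (Omega `&` V xi) p v)%E /\
      (kobayashi (Omega `&` V xi) p v <=
       (expR (c * fine (dist_bd Omega p) `^ L%:R^-1))%:E * kobayashi Omega p v)%E.
Proof.
move=> oO [M' bO'] _ _ [atlas [C [tau [C0 [tau0 good]]]]].
pose M := Num.max 1 M'.
have M0 : 0 < M by rewrite lt_max ltr01.
have bO z : Omega z -> enorm z <= M by move=> /bO' h; rewrite le_max h orbT.
have sub xi : Omega `&` V xi `<=` Omega by move=> y [].
(* For [L = 0] the inverse of [L%:R] is 0 by convention, so the exponential is the constant
   [expR c]. *)
have [L0|L0] := posnP L.
  exists (16 * M / tau), (tau / 4); split; first by rewrite divr_gt0// mulr_gt0.
  split; first by rewrite divr_gt0.
  move=> xi p v bxi pxi Op; split; first exact: kobayashi_subset.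
  have k0 : 0 <= 16 * M / tau by rewrite divr_ge0 ?mulr_ge0// ltW.
  apply: (kobayashi_localization _ _ _ _ _ _ (1 + 16 * M / tau)^-1).
  - by rewrite invr_gt0; lra.
  - by rewrite invf_le1; lra.
  - by rewrite invrK L0 invr0 powRr0 mulr1 expR_ge1Dx.
  move=> f hf fO f0 z zr; have [tauV _] := good xi bxi.
  apply: tauV.
  exact: (confinement_constant R d Omega xi p tau M f tau0 M0 bO pxi hf fO f0 z zr).
pose K := 8 * C / (tau / (16 * C ^+ 2 * L%:R)) ^+ L.
pose C' := 32 * M * K / tau.
have L0' : 0 < L%:R :> R by rewrite ltr0n.
have th0 : 0 < tau / (16 * C ^+ 2 * L%:R) by rewrite divr_gt0 // !mulr_gt0 // exprn_gt0.
have K0 : 0 < K by rewrite /K divr_gt0 ?mulr_gt0 // exprn_gt0.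
have C'0 : 0 < C' by rewrite /C' divr_gt0// mulr_gt0// mulr_gt0.
(* Since [delta <= enorm (p - xi) < eps], the three entries give the smallness required for
   confinement, [delta <= 1], and [C' * delta <= 1 / 2]. *)
pose eps := Num.min (tau / 4) (Num.min 1 (1 / (2 * C'))).
have eps0 : 0 < eps by rewrite /eps !lt_min ltr01 !divr_gt0// mulr_gt0.
exists (2 * C'), eps; split; first by rewrite mulr_gt0.
split => // xi p v bxi pxi Op; split; first exact: kobayashi_subset.
have [_ [bihol cW]] := atlas xi bxi.
have [tauV [typeW lip]] := good xi bxi.
have Oxi : ~ Omega xi by case: bxi.
have [d0 dxi [q Oq qp]] := dist_bd_near_exterior R d Omega p xi oO Op Oxi.
set delta := fine (dist_bd Omega p) in d0 dxi qp *.
move: pxi; rewrite /eball /= => pxi.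
have := pxi; rewrite !lt_min => /andP[pt /andP[p1 pC]].
have dC : C' * delta <= 1 / 2.
  have C2 : 0 < 2 * C' by rewrite mulr_gt0.
  have h := le_trans dxi (ltW pC); rewrite (ler_pdivlMr _ _ C2) in h.
  by move: h; lra.
have Cd : 0 < C' * delta by rewrite mulr_gt0.
apply: (kobayashi_localization _ _ _ _ _ _ (1 - C' * delta)).
- by lra.
- by lra.
(* This holds because [C' * delta <= 1 / 2]. The loss is linear in [delta], and [delta <= 1] allows
   replacing [delta] by its L-th root before passing to the exponential. *)
- have h1 : (1 - C' * delta)^-1 <= 1 + 2 * C' * delta.
    rewrite -div1r ler_pdivrMr; last by lra.
    have : 0 <= (C' * delta) * (1 / 2 - C' * delta).
      by rewrite mulr_ge0 ?(ltW Cd)// subr_ge0.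
    by lra.
  apply: (le_trans h1); apply: le_trans (expR_ge1Dx _).
  have C2 : 0 <= 2 * C' by rewrite mulr_ge0// ltW.
  rewrite lerD2l ler_wpM2l//.
  by apply: le_powR_invn => //; [exact: ltW|exact/ltW/(le_lt_trans dxi)].
move=> f hf fO f0 z zr; apply: (tauV).
have dt : delta <= tau / 4 by rewrite (le_trans dxi) ?ltW.
exact: (confinement R d L Omega (V xi) (Phi xi) xi p q tau C M delta f tau0 C0 M0 d0
  oO bO bihol cW tauV lip typeW Oq qp pt dt hf fO f0 z L0 zr).
Qed.
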